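(* Let $K$ be a field of characteristic $0$ with henselian valuation ring $A$, valuation $v$ and residue field $k$ of characteristic $p>0$, and assume $K$ contains a primitive $p$-th root of unity $\zeta$. Let $L=K(\alpha)$ be a non-trivial Kummer extension with $\alpha^p=h\in K^\times$, let $B$ be the integral closure of $A$ in $L$, let $\sigma$ be the generator of $\mathrm{Gal}(L|K)$ with $\sigma(\alpha)=\zeta\alpha$, and let $N=N_{L|K}$ be the norm. Put $\mathfrak{z}=\zeta-1$. Then $$\mathcal{H}=\mathcal{N}_\sigma$$ as ideals of $A$, where $\mathcal{H}$ and $\mathcal{N}_\sigma$ are defined below.
   Context: $B$ is a valuation ring (since $A$ is henselian). Let $\mathfrak{A}$ be the set of $h\in K$ such that the solutions of $X^p=h$ generate $L$ over $K$. Define the ideal $\mathcal{J}_\sigma$ of $B$ generated by $\{\sigma(b)/b-1 : b\in L^\times\}$, the ideal $\mathcal{H}$ of $A$ generated by $\{\mathfrak{z}^p/(h-1): h\in\mathfrak{A}\}$, and the ideal $\mathcal{N}_\sigma$ of $A$ generated by $N(\mathcal{J}_\sigma)$. *)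

(* Defs.v *)
From HB Require Import structures.
From mathcomp Require Import all_boot all_order all_algebra all_field.
Set Implicit Arguments. Unset Strict Implicit. Unset Printing Implicit Defensive.
Import Order.TTheory GRing.Theory Num.Theory.
Local Open Scope ring_scope.

(* Generic submodule generation: the set of finite R-linear combinations
   sum_i r_i * s_i with r_i in Rsub and s_i in S.  When Rsub is a subring
   and S is a subset of Rsub this is the ideal of Rsub generated by S. *)
Definition gen_by (T : comPzRingType) (Rsub S : T -> Prop) (x : T) : Prop :=
  exists n (r s : 'I_n -> T),
    (forall i, Rsub (r i)) /\ (forall i, S (s i)) /\ x = \sum_(i < n) r i * s i.

Section Val.
Variable K : fieldType.
Variable A : K -> Prop.

Definition is_subring : Prop :=
  A 1 /\ (forall x y, A x -> A y -> A (x - y)) /\ (forall x y, A x -> A y -> A (x * y)).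

Definition is_valuation_ring : Prop :=
  is_subring /\ forall x : K, x != 0 -> A x \/ A x^-1.

Definition max_ideal (x : K) : Prop := A x /\ ~ (x != 0 /\ A x^-1).

Definition coefs_in (f : {poly K}) : Prop := forall i, A f`_i.

Definition is_henselian_valuation_ring : Prop :=
  is_valuation_ring /\
  forall (f : {poly K}) (a : K), f \is monic -> coefs_in f -> A a ->
    max_ideal f.[a] -> ~ max_ideal (f^`()).[a] ->
    exists b, A b /\ f.[b] = 0 /\ max_ideal (b - a).
End Val.

Section Ext.
Variables (K : fieldType) (L : splittingFieldType K) (A : K -> Prop).

Definition integral_closure (x : L) : Prop :=
  exists f : {poly K}, f \is monic /\ coefs_in A f /\ root (map_poly (in_alg L) f) x.

Definition kummer_gens (p : nat) (h : K) : Prop :=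
  forall E : {subfield L}, (forall y : L, y ^+ p = h%:A -> y \in E) -> E = fullv :> {vspace L}.

Definition J_gens (s : gal_of {:L}) (x : L) : Prop :=
  exists b : L, b != 0 /\ x = s b / b - 1.

Definition J_sigma (s : gal_of {:L}) : L -> Prop :=
  gen_by integral_closure (J_gens s).

Definition norm_J (s : gal_of {:L}) (c : K) : Prop :=
  exists x : L, J_sigma s x /\ galNorm 1 {:L} x = c%:A.

Definition N_sigma (s : gal_of {:L}) : K -> Prop := gen_by A (norm_J s).

Definition H_ideal (p : nat) (zeta : K) : K -> Prop :=
  gen_by A (fun c => exists h, kummer_gens p h /\ c = (zeta - 1) ^+ p / (h - 1)).
End Ext.

(* Main.v *)
(* The integral closure B of A in any finite Galois extension M of K is a
   valuation ring: if a maximal ideal I of B had a stabilizer Z smaller than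
   Gal(M|K), the Chinese remainder theorem would give a Z-invariant element
   congruent to 1 modulo I with all its other conjugates in I, and Hensel's lemma
   applied to its minimal polynomial at 1 would put this element in K.  So B is
   local, and Kronecker's theorem on the coefficients of factors then makes it a
   valuation ring.

   Consequently every element of J_sigma is a multiple in B of some
   sigma(b)/b - 1, and the theorem amounts to comparing norms of such elements
   with z^p/(h - 1).  If y^p = h then b = 1 - 1/y has N(sigma(b)/b - 1) equal to
   z^p/(h - 1) up to a unit.  Conversely, write b = g(alpha) with deg g < p and
   adjoin to L the roots beta of g.  Some tau in the Galois group has
   tau(alpha) = zeta alpha and fixes every beta, these having fewer than p
   conjugates.  Factoring tau(b)/b along the linear factors of g gives
     v(sigma(b)/b - 1) >= v((zeta alpha - alpha)/(alpha - beta))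
   for the root beta closest to alpha.  Averaging beta over its conjugates, whose
   number is prime to p, replaces it by an element a of K, and
   N(alpha/(alpha - a)) = 1/(1 - a^p/h0). *)
Require Import Defs.
From HB Require Import structures.
From mathcomp Require Import all_boot all_order all_algebra all_field.
From mathcomp Require Import all_fingroup boolp classical_sets ring.
Import GRing.Theory.
Local Open Scope ring_scope.

Set Implicit Arguments.
Unset Strict Implicit.
Unset Printing Implicit Defensive.

(** * Subrings as ring types, and integrality over them *)

Section SubringType.
Variables (K : fieldType) (A : K -> Prop).

(** The proof of [is_subring A] is a parameter so that the closure instance can be declared on the
    predicate itself. *)
Definition subring_pred of is_subring A : {pred K} := fun x => `[< A x >].

Hypothesis subringA : is_subring A.

Fact subring_pred_closed : subring_closed (subring_pred subringA).
Proof.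
case: subringA => A1 [AB AM]; split.
- exact/asboolP.
- by move=> x y /asboolP Ax /asboolP Ay; apply/asboolP/AB.
- by move=> x y /asboolP Ax /asboolP Ay; apply/asboolP/AM.
Qed.

HB.instance Definition _ :=
  GRing.isSubringClosed.Build K (subring_pred subringA) subring_pred_closed.

Record subring_type := SubringType {
  subring_val : K; _ : subring_val \in subring_pred subringA }.

HB.instance Definition _ := [isSub for subring_val].
HB.instance Definition _ := [Choice of subring_type by <:].
HB.instance Definition _ := [SubChoice_isSubComNzRing of subring_type by <:].

Lemma subring_valP (x : subring_type) : A (val x).
Proof. exact/asboolP/(valP x). Qed.

Lemma subring_lift x : A x -> exists y : subring_type, val y = x.
Proof.
move=> Ax; have Px : x \in subring_pred subringA by apply/asboolP.
by exists (SubringType Px).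
Qed.
End SubringType.

Section IntegralClosure.
Variables (K : fieldType) (A : K -> Prop).
Hypothesis subringA : is_subring A.

Lemma coefs_in_lift (f : {poly K}) : coefs_in A f ->
  exists g : {poly subring_type subringA}, map_poly val g = f.
Proof.
move=> Af; have /choice[c Dc] i := subring_lift subringA (Af i).
exists (\poly_(i < size f) c i); apply/polyP=> i.
rewrite coef_map coef_poly /=; case: ltnP => [_ | le_f_i]; first exact: Dc.
by rewrite nth_default //; apply: (rmorph0 val).
Qed.

Lemma subring1 : A 1. Proof. by case: subringA. Qed.
Lemma subringB x y : A x -> A y -> A (x - y).
Proof. by case: subringA => _ [AB _]; apply: AB. Qed.
Lemma subringM x y : A x -> A y -> A (x * y).
Proof. by case: subringA => _ [_ AM]; apply: AM. Qed.
Lemma subring0 : A 0. Proof. by rewrite -(subrr 1); apply: subringB subring1 subring1. Qed.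
Lemma subringN x : A x -> A (- x).
Proof. by rewrite -sub0r; apply: subringB subring0. Qed.
Lemma subringD x y : A x -> A y -> A (x + y).
Proof. by move=> Ax Ay; rewrite -[y]opprK; apply/subringB/subringN. Qed.
Lemma subringX x n : A x -> A (x ^+ n).
Proof.
by move=> Ax; elim: n => [|n IHn]; rewrite ?expr0 ?exprS; [apply: subring1 | apply: subringM].
Qed.
Lemma subring_sum (I : Type) (r : seq I) (P : pred I) F :
  (forall i, P i -> A (F i)) -> A (\sum_(i <- r | P i) F i).
Proof. by move=> AF; elim/big_ind: _ => //; [apply: subring0 | apply: subringD]. Qed.
Lemma subring_prod (I : Type) (r : seq I) (P : pred I) F :
  (forall i, P i -> A (F i)) -> A (\prod_(i <- r | P i) F i).
Proof. by move=> AF; elim/big_ind: _ => //; [apply: subring1 | apply: subringM]. Qed.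
Lemma subring_nat n : A n%:R.
Proof. by elim: n => [|n IHn]; [apply: subring0 | rewrite -natr1; apply/subringD/subring1]. Qed.

End IntegralClosure.

Section IntegralClosureExt.
Variables (K : fieldType) (A : K -> Prop) (L : splittingFieldType K).
Hypothesis subringA : is_subring A.
Local Notation B := (@integral_closure K L A).
Local Notation AtoL := (in_alg L \o (val : subring_type subringA -> K)).

(** Polynomials over [K] with coefficients in [A] are traded for polynomials over the ring type of
    [A], which makes the library's closure properties of integral elements available. *)
Lemma integral_closureE x : B x <-> integralOver AtoL x.
Proof.
split=> [[f [mon_f [Af fx0]]] | [f mon_f fx0]].
  have [g Dg] := coefs_in_lift subringA Af; exists g.
    rewrite -Dg in mon_f; apply/eqP/val_inj.
    by rewrite -lead_coef_map_inj ?rmorph0 //; [apply/eqP | apply: val_inj].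
  by rewrite map_poly_comp /= Dg.
exists (map_poly val f); split; first exact: monic_map.
split; last by rewrite -map_poly_comp.
by move=> i; rewrite coef_map; apply: subring_valP.
Qed.

Lemma int_closed_alg a : A a -> B a%:A.
Proof.
move=> /(subring_lift subringA)[y <-]; apply/integral_closureE.
exact: (integral_id AtoL y).
Qed.

Lemma int_closed_subring : is_subring B.
Proof.
split; first by have := int_closed_alg (subring1 subringA); rewrite scale1r.
split=> x y /integral_closureE Bx /integral_closureE By; apply/integral_closureE.
  exact: integral_sub.
exact: integral_mul.
Qed.

(** Transitivity of integrality: a monic equation over [B] serves as well as one over [A]. *)
Lemma int_closed_root (f : {poly L}) x :
  f \is monic -> (forall i, B f`_i) -> root f x -> B x.
Proof.
move=> mon_f Bf fx0; apply/integral_closureE.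
apply: (integral_root_monic mon_f fx0); apply/integral_poly=> i.
exact/integral_closureE.
Qed.

Lemma int_closed_gal (s : gal_of {:L}) x :
  s \in 'Gal({:L} / 1%VS)%g -> B x -> B (s x).
Proof.
move=> Gs [f [mon_f [Af fx0]]]; exists f; split=> //; split=> //.
have Df : map_poly s (map_poly (in_alg L) f) = map_poly (in_alg L) f.
  by rewrite -map_poly_comp; apply: eq_map_poly => a /=; rewrite rmorph_alg.
by rewrite -Df fmorph_root.
Qed.
End IntegralClosureExt.

(** * Valuation rings, treated through divisibility *)

Section ValuationRing.
Variables (F : fieldType) (V : F -> Prop).
Hypothesis valV : is_valuation_ring V.
Let subringV : is_subring V := valV.1.

Lemma valuation_div_total x y : V (x / y) \/ V (y / x).
Proof.
have [-> | nz_x] := eqVneq x 0; first by left; rewrite mul0r; apply: subring0.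
have [-> | nz_y] := eqVneq y 0; first by right; rewrite mul0r; apply: subring0.
have nz_xy : x / y != 0 by rewrite mulf_neq0 ?invr_eq0.
by have := valV.2 _ nz_xy; rewrite invf_div.
Qed.

(** Divisibility is total, so some nonzero member of a finite list divides all the others. It stands
    for an element of least value; no value group is formed. *)
Lemma valuation_min_seq (s : seq F) x : x \in s -> x != 0 ->
  exists2 d, d \in s & d != 0 /\ forall y, y \in s -> V (y / d).
Proof.
elim: s x => // a s IHs x s_x nz_x.
have [[d s_d [nz_d minD]] | s0] :=
  pselect (exists2 d, d \in s & d != 0 /\ forall y, y \in s -> V (y / d)).
  have [Vad | Vda] := valuation_div_total a d.
    by exists d; rewrite ?inE ?s_d ?orbT //; split=> // y /predU1P[-> // | /minD].
  have [a0 | nz_a] := eqVneq a 0.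
    exists d; rewrite ?inE ?s_d ?orbT //; split=> // y /predU1P[-> | /minD //].
    by rewrite a0 mul0r; apply: subring0.
  exists a; rewrite ?inE ?eqxx //; split=> // y /predU1P[-> | /minD Vyd].
    by rewrite divff //; apply: subring1.
  by rewrite -(mulr1 y) -(mulVf nz_d) mulrA -mulrA; apply: subringM.
have Ds y : y \in s -> y = 0 by move=> s_y; apply: contra_notP s0 => /eqP/(IHs _ s_y).
move: s_x; rewrite inE => /predU1P[Dx | /Ds x0]; last by rewrite x0 eqxx in nz_x.
exists a; rewrite ?inE ?eqxx // -Dx; split=> // y /predU1P[-> | /Ds->].
  by rewrite divff //; apply: subring1.
by rewrite mul0r; apply: subring0.
Qed.

(** Put [c = 1 - x * y]. If [x] divided [c], then [1/x = c/x + y] would lie in [V]; so [c] divides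
    [x], and [1/c = 1 + (x/c) * y] lies in [V]. *)
Lemma max_ideal_subr x y : max_ideal V x -> V y ->
  1 - x * y != 0 /\ V (1 - x * y)^-1.
Proof.
move=> [Vx x'unit] Vy; set c := 1 - x * y.
have Dc : c + x * y = 1 by rewrite subrK.
have [x0 | nz_x] := eqVneq x 0.
  by rewrite /c x0 mul0r subr0 invr1 oner_eq0; split=> //; apply: subring1.
have [c0 | nz_c] := eqVneq c 0.
  case: x'unit; split=> //; rewrite c0 add0r in Dc.
  by rewrite -(mulr1 x^-1) -Dc mulKf.
split=> //; have [Vcx | Vxc] := valuation_div_total c x.
  case: x'unit; split=> //; rewrite -(mulr1 x^-1) -Dc mulrDr mulKf //.
  by apply: subringD => //; rewrite mulrC.
rewrite -(mulr1 c^-1) -Dc mulrDr mulVf // mulrA [_ * x]mulrC.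
by apply: subringD (subring1 _) _ => //; apply: subringM.
Qed.

Lemma unit_or_max_ideal x : V x -> ~ max_ideal V x -> x != 0 /\ V x^-1.
Proof. by move=> Vx max'x; apply: contra_notP max'x. Qed.

(** By Bezout some multiple [u * n] has the form [1 + v * p], which is a unit because [p] lies in
    the maximal ideal. *)
Lemma coprime_val_unit p n : max_ideal V p%:R -> coprime p n ->
  n%:R != 0 :> F /\ V n%:R^-1.
Proof.
(* For [n = 0] coprimality forces [p = 1], which is outside the maximal ideal. *)
move=> max_p co_p_n; have [n0 | n_gt0] := posnP n.
  case: max_p => _ []; rewrite n0 /coprime gcdn0 in co_p_n.
  by rewrite (eqP co_p_n) invr1 oner_eq0; split=> //; apply: subring1.
have [u v Duv _] := egcdnP p n_gt0.
have Vv : V (- v%:R) by apply: subringN => //; apply: subring_nat.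
have := max_ideal_subr max_p Vv; rewrite mulrN opprK.
rewrite gcdnC (eqP co_p_n) addn1 in Duv.
rewrite -natrM addrC natr1 mulnC -Duv natrM mulf_eq0 invfM negb_or.
case=> /andP[nz_u nz_n] Vun; split=> //.
by rewrite -(mulVKf nz_u n%:R^-1); apply: subringM => //; apply: subring_nat.
Qed.

(** A valuation ring is integrally closed: if [1/a] lies in [V], a monic equation of degree [n + 1]
    divided by [a ^+ n] writes [a] as a polynomial in [1/a] over [V]. *)
Lemma int_closed_valuation (M : splittingFieldType F) a :
  integral_closure V (a%:A : M) -> V a.
Proof.
case=> f [mon_f [Vf]]; rewrite -[a%:A]/(in_alg M a) /root horner_map fmorph_eq0 => /eqP fa0.
have [-> | nz_a] := eqVneq a 0; first exact: subring0.
have [// | Va] := valV.2 a nz_a.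
have Dn: size f = (size f).-1.+1 by rewrite prednK // size_poly_gt0 monic_neq0.
have Df: f`_(size f).-1 = 1 by apply/eqP; rewrite -monicE.
move: fa0; rewrite horner_coef Dn big_ord_recr /= Df mul1r.
case: _.-1 => [|n].
  by rewrite big_ord0 add0r expr0 => /eqP; rewrite oner_eq0.
move/eqP; rewrite addrC addr_eq0 => /eqP Dan.
rewrite -[a](mulfK (expf_neq0 n nz_a)) -exprS Dan -sumrN mulr_suml.
apply: subring_sum => // -[i /= lt_i_n] _; rewrite mulNr -mulrA.
apply: subringN => //; apply: subringM => //.
have -> : a ^+ i / a ^+ n = a^-1 ^+ (n - i).
  by rewrite exprVn expfB_cond ?invf_div // (negPf nz_a).
exact: subringX.
Qed.
End ValuationRing.

Lemma drop_polyS (R : nzRingType) (p : {poly R}) j :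
  drop_poly j p = (p`_j)%:P + drop_poly j.+1 p * 'X.
Proof.
apply/polyP=> l; rewrite coef_drop_poly coefD coefC coefMX coef_drop_poly.
by case: l => [|l] /=; rewrite ?addr0 ?add0r ?addSnnS.
Qed.

(** * Norms of integral elements, and why a local integral closure is a valuation ring *)

Section IntegralClosureLocal.
Variables (K : fieldType) (A : K -> Prop) (M : splittingFieldType K).
Hypotheses (henselA : is_henselian_valuation_ring A) (galM1 : galois 1 {:M}).
Let valA : is_valuation_ring A := henselA.1.
Let subringA : is_subring A := valA.1.
Local Notation B := (@integral_closure K M A).
Local Notation G := ('Gal({:M} / 1%VS))%g.
Let subB : is_subring B := int_closed_subring M subringA.

(* Kronecker: if [p = sum_l p_l X^l] has integral coefficients and kills [x],
   then [h = sum_(l >= i) p_l x^(l - i)] and [h x] are integral, because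
   [h^i p(x) = 0] is a monic equation for [h x]. *)
Lemma int_closed_drop_poly (p : {poly M}) x i :
  (forall l, B p`_l) -> p.[x] = 0 ->
  B (drop_poly i p).[x] /\ ((0 < i)%N -> B ((drop_poly i p).[x] * x)).
Proof.
move=> Bp px0; have stepB j : B (drop_poly j.+1 p).[x] -> B ((drop_poly j.+1 p).[x] * x).
  set h := _.[x] => Bh; pose q := \poly_(l < j.+1) (p`_l * h ^+ (j - l)).
  apply: (@int_closed_root _ _ _ subringA ('X^(j.+1) + q)).
  - rewrite monicE lead_coefDl ?lead_coefXn // size_polyXn ltnS; exact: size_poly.
  - move=> l; rewrite coefD coefXn coef_poly; apply: subringD => //.
      exact: subring_nat.
    case: ifP => _; last exact: subring0.
    by apply: subringM => //; apply: subringX.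
  rewrite /root hornerD hornerXn horner_poly.
  apply/eqP; transitivity (h ^+ j * p.[x]); last by rewrite px0 mulr0.
  rewrite -[in RHS](poly_take_drop j.+1 p).
  rewrite hornerD hornerM hornerXn -/h horner_poly mulrDr addrC mulr_sumr exprMn.
  congr (_ + _); last by rewrite mulrA -exprSr.
  apply: eq_bigr => l _; rewrite exprMn mulrACA -mulrA.
  have le_l_j: (l <= j)%N by rewrite -ltnS ltn_ord.
  have -> : h ^+ j = h ^+ (j - l) * h ^+ l by rewrite -exprD subnK.
  by ring.
suffices Bh j : B (drop_poly j p).[x] by case: i => [|i]; split=> // _; apply: stepB.
have [n le_p_jn] : exists n, (size p <= j + n)%N by exists (size p); apply: leq_addl.
elim: n j le_p_jn => [|n IHn] j le_p_jn.
  rewrite (_ : drop_poly j p = 0) ?horner0; first exact: subring0.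
  by apply: drop_poly_eq0; rewrite addn0 in le_p_jn.
rewrite drop_polyS hornerD hornerC hornerM hornerX; apply: subringD => //.
by apply/stepB/IHn; rewrite addSnnS.
Qed.

(** The minimal polynomial of [x] over [K] is divided by a coefficient of least value. *)
Lemma primitive_relation x :
  exists p : {poly M}, [/\ forall l, B p`_l, p.[x] = 0 & exists j, p`_j = 1].
Proof.
have /polyOver1P[f Df] := minPolyOver 1 x.
have nz_lf : f`_(size f).-1 != 0.
  rewrite -/(lead_coef f) lead_coef_eq0 -(map_poly_eq0 (in_alg M)) -Df.
  exact: monic_neq0 (monic_minPoly _ _).
have s_lf : f`_(size f).-1 \in (f : seq K).
  by rewrite mem_nth // prednK // lt0n; apply: contraNneq nz_lf => f0; rewrite nth_default ?f0.
have [d /(nthP 0)[j ltjf Dd] [nz_d min_d]] := valuation_min_seq valA s_lf nz_lf.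
exists (map_poly (in_alg M) (d^-1 *: f)); split.
- move=> l; rewrite coef_map coefZ; apply: int_closed_alg => //.
  have [lt_l_f | le_f_l] := ltnP l (size f); last first.
    by rewrite nth_default // mulr0; apply: subring0.
  by rewrite mulrC; apply/min_d/mem_nth.
- by rewrite linearZ /= hornerZ -Df minPolyxx mulr0.
by exists j; rewrite coef_map coefZ Dd mulVf //= scale1r.
Qed.

Lemma int_closed_alg_inv a : B a%:A -> A a.
Proof. exact: int_closed_valuation. Qed.

Lemma fixed_alg x : (forall s, s \in G -> s x = x) -> exists a, x = a%:A.
Proof.
move=> fix_x; apply/vlineP; have /galois_fixedField <- := galM1.
by apply/fixedFieldP; rewrite ?memvf.
Qed.

Lemma galNorm_alg x : exists a, galNorm 1 {:M} x = a%:A.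
Proof. exact/vlineP/mem_galNorm/memvf. Qed.

Lemma int_closed_galNorm x : B x -> exists2 a, A a & galNorm 1 {:M} x = a%:A.
Proof.
move=> Bx; have [a Da] := galNorm_alg x; exists a => //.
apply: int_closed_alg_inv; rewrite -Da; apply: subring_prod => // s Gs.
exact: int_closed_gal.
Qed.

Lemma galNorm_cofactor x : B x -> exists2 y, B y & galNorm 1 {:M} x = x * y.
Proof.
move=> Bx; rewrite /galNorm (bigD1 1%g) ?group1 //= gal_id.
eexists; last by [].
by apply: subring_prod => // s /andP[Gs _]; apply: int_closed_gal.
Qed.

(** Let [r] and [s] be the values at [x] of the tails of a primitive relation from degrees [j] and
    [j + 1], where the coefficient at [j] is 1. Then [r - s * x = 1] with both terms integral, so
    one is a unit: either [x = (r * x) / r] or [1/x = s / (s * x)] is integral. *)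
Lemma local_int_closed_valuation :
  (forall r s, B r -> B s -> r - s = 1 -> B r^-1 /\ r != 0 \/ B s^-1 /\ s != 0) ->
  is_valuation_ring B.
Proof.
move=> localB; split=> // x nz_x.
have [p [Bp px0 [j Dpj]]] := primitive_relation x.
have [Br Brx] := int_closed_drop_poly j Bp px0.
have [Bs /(_ isT) Bsx] := int_closed_drop_poly j.+1 Bp px0.
set s := (drop_poly j.+1 p).[x] in Bs Bsx; set r := (drop_poly j p).[x] in Br Brx.
have Dr : r = 1 + s * x.
  by rewrite /r drop_polyS hornerD hornerC hornerM hornerX Dpj.
have rs1 : r - s * x = 1 by rewrite Dr addrK.
have [[Bir nz_r] | [Bis nz_s]] := localB _ _ Br Bsx rs1.
  left; rewrite -(mulKf nz_r x); apply: subringM => //; apply: Brx.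
  (* Integrality of [r * x] needs [j > 0]; for [j = 0] the tail is the whole relation, and [r] would
     be 0. *)
  rewrite lt0n; apply: contraNneq nz_r => j0; rewrite /r j0 drop_poly0l.
  exact/eqP.
right; have [nz_s1 _] : s != 0 /\ x != 0 by apply/andP; rewrite -negb_or -mulf_eq0.
by rewrite -(mulKf nz_s1 x^-1) mulrCA -invfM; apply: subringM.
Qed.
End IntegralClosureLocal.

(** * Existence of maximal ideals *)

(** Membership of 0 is not demanded, so that the empty set, which is the union of the empty chain,
    qualifies in Zorn's lemma. Maximality restores it. *)
Definition proper_ideal (F : fieldType) (V I : F -> Prop) : Prop :=
  [/\ forall x, I x -> V x, forall x y, I x -> I y -> I (x + y),
      forall b x, V b -> I x -> I (b * x) & ~ I 1].

(** Zorn's lemma, with maximality put in comaximal form: adding an outside element [x] of [V] to [I]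
    produces 1. *)
Lemma maximal_proper_ideal (F : fieldType) (V : F -> Prop) : is_subring V ->
  exists I, [/\ proper_ideal V I, I 0
    & forall x, V x -> ~ I x -> exists i b, [/\ I i, V b & 1 = i + b * x]].
Proof.
move=> subV; pose P : set (set F) := fun I => proper_ideal V I.
have [C PC totC | I [PI maxI]] := @Zorn_bigcup F P.
  split=> [x [I CI /(let: And4 VI _ _ _ := PC I CI in VI x)] // | x y | b x Vb | [I CI I1]].
  - move=> [I CI Ix] [J CJ Jy].
    have [sIJ | sJI] := totC I J CI CJ.
      by exists J => //; have [_ addJ _ _] := PC J CJ; apply: addJ => //; apply: sIJ.
    by exists I => //; have [_ addI _ _] := PC I CI; apply: addI => //; apply: sJI.
  - by move=> [I CI Ix]; exists I => //; have [_ _ mulI _] := PC I CI; apply: mulI.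
  by have [_ _ _] := PC I CI.
have [VI addI mulI I'1] := PI.
(* [J x] is the ideal generated by [I] and [x]; the alternative [i = 0] covers an [I] not yet known
   to be nonempty. *)
pose J x := fun z => exists i b, [/\ I i \/ i = 0, V b & z = i + b * x].
have subIJ x : (I `<=` J x)%classic.
  by move=> z Iz; exists z, 0; rewrite mul0r addr0; split; [left | apply: subring0 |].
have Jx x : J x x.
  by exists 0, 1; rewrite mul1r add0r; split; [right | apply: subring1 |].
have idJ x : V x -> ~ J x 1 -> proper_ideal V (J x).
  move=> Vx J'1; split=> // [_ [i [b [Ii Vb ->]]] |
    _ _ [i [b [Ii Vb ->]]] [j [c [Ij Vc ->]]] | c _ Vc [i [b [Ii Vb ->]]]].
  - apply: subringD => //; last exact: subringM.
    by case: Ii => [/VI // | ->]; apply: subring0.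
  - exists (i + j), (b + c); split; last by ring.
      case: Ii Ij => [Ii | ->] [Ij | ->]; rewrite ?addr0 ?add0r.
      - by left; apply: addI.
      - by left.
      - by left.
      - by right.
    exact: subringD.
  exists (c * i), (c * b); split; [|exact: subringM | by ring].
  by case: Ii => [Ii | ->]; [left; apply: mulI | right; rewrite mulr0].
have J1 x : V x -> ~ I x -> J x 1.
  move=> Vx I'x; apply: contrapT => J'1; apply: (maxI (J x)); last exact: idJ.
  by split=> // sJI; apply/I'x/sJI/Jx.
have I0 : I 0.
  apply: contrapT => I'0; have [i [b [Ii Vb]]] := J1 0 (subring0 subV) I'0.
  rewrite mulr0 addr0 => Di; case: Ii; rewrite -Di // => /eqP.
  by rewrite oner_eq0.
exists I; split=> // x Vx /(J1 x Vx)[i [b [Ii Vb D1]]].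
by exists i, b; split=> //; case: Ii => [|->].
Qed.

(** * Galois stability of a maximal ideal of the integral closure *)

Section MaximalIdeal.
Variables (K : fieldType) (A : K -> Prop) (M : splittingFieldType K).
Hypotheses (henselA : is_henselian_valuation_ring A) (galM1 : galois 1 {:M}).
Let valA : is_valuation_ring A := henselA.1.
Let subringA : is_subring A := valA.1.
Local Notation B := (@integral_closure K M A).
Local Notation G := ('Gal({:M} / 1%VS))%g.
Let subB : is_subring B := int_closed_subring M subringA.

Variable I : M -> Prop.
Hypotheses (idealI : proper_ideal B I) (I0 : I 0).
Hypothesis maxI :
  forall x, B x -> ~ I x -> exists i b, [/\ I i, B b & 1 = i + b * x].

Let BI x : I x -> B x. Proof. by case: idealI => BI _ _ _; apply: BI. Qed.
Let addI x y : I x -> I y -> I (x + y).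
Proof. by case: idealI => _ addI _ _; apply: addI. Qed.
Let mulI b x : B b -> I x -> I (b * x).
Proof. by case: idealI => _ _ mulI _; apply: mulI. Qed.
Let I'1 : ~ I 1. Proof. by case: idealI. Qed.
Let mulIr b x : B b -> I x -> I (x * b).
Proof. by rewrite mulrC; apply: mulI. Qed.
Let subI x y : I x -> I y -> I (x - y).
Proof.
move=> Ix Iy; rewrite -mulN1r; apply: addI => //; apply: mulI => //.
by apply: subringN => //; apply: subring1.
Qed.

Lemma maximal_ideal_prime x y : B x -> B y -> I (x * y) -> I x \/ I y.
Proof.
move=> Bx By Ixy; apply: contrapT => /not_orP[/(maxI Bx)[i [b [Ii Bb D1]]] I'y].
by apply: I'y; rewrite -[y]mul1r D1 mulrDl -mulrA; apply: addI; [apply: mulIr | apply: mulI].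
Qed.

Lemma maximal_ideal_prod (J : finType) (P : pred J) (f : J -> M) :
  (forall i, P i -> B (f i)) -> I (\prod_(i | P i) f i) -> exists2 i, P i & I (f i).
Proof.
move=> Bf If; apply: contrapT => noI.
have [_] : B (\prod_(i | P i) f i) /\ ~ I (\prod_(i | P i) f i).
  elim/big_rec: (\prod_(i | P i) f i) => [|i x Pi [Bx I'x]]; first by split=> //; apply: subring1.
  split; first by apply: subringM => //; apply: Bf.
  by case/(maximal_ideal_prime (Bf i Pi) Bx) => // Ifi; apply: noI; exists i.
by apply.
Qed.

Lemma prod_congr1 (J : Type) (r : seq J) (P : pred J) (f : J -> M) :
  (forall i, P i -> I (1 - f i)) -> I (1 - \prod_(i <- r | P i) f i).
Proof.
move=> If; elim/big_rec: _ => [|i x Pi Ix]; first by rewrite subrr.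
have -> : 1 - f i * x = 1 - f i + f i * (1 - x) by ring.
apply: addI; [exact: If | apply: mulI => //].
have -> : f i = 1 - (1 - f i) by ring.
by apply: subringB => //; [apply: subring1 | apply/BI/If].
Qed.

Lemma max_ideal_below a : A a -> I a%:A -> max_ideal A a.
Proof.
move=> Aa Ia; split=> // -[nz_a Aia]; apply: I'1.
have -> : 1 = a^-1%:A * a%:A :> M by rewrite -in_algE -rmorphM mulVf ?rmorph1.
by apply: mulI => //; apply: int_closed_alg.
Qed.

(** Otherwise [1 = i + b * a] with [i] in [I]. The norm of [i = 1 - b * a] lies in [I], being a
    multiple of [i], and has the form [1 - a * c] with [c] in [A], which is a unit. *)
Lemma max_ideal_above a : max_ideal A a -> I a%:A.
Proof.
move=> max_a; have [Aa _] := max_a; have Ba : B a%:A by apply: int_closed_alg.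
apply: contrapT => /(maxI Ba)[i [b [Ii Bb D1]]].
have Bs s : s \in G -> B (s b * a%:A).
  by move=> Gs; apply: subringM => //; apply: int_closed_gal.
have [c Ac Nc] : exists2 c, A c & galNorm 1 {:M} (1 - b * a%:A) = (1 - a * c)%:A.
  rewrite /galNorm; have [c Bc Dc] :
      exists2 c, B c & \prod_(s in G) s (1 - b * a%:A) = 1 - a%:A * c.
    elim/big_rec: _ => [|s x Gs [c Bc ->]].
      by exists 0; [apply: subring0 | rewrite mulr0 subr0].
    exists (c + s b * (1 - a%:A * c)).
      apply: subringD => //; apply: subringM => //; first exact: int_closed_gal.
      by apply: subringB => //; [apply: subring1 | apply: subringM].
    have -> : s (1 - b * a%:A) = 1 - s b * a%:A.
      rewrite rmorphB rmorph1; congr (_ - _); rewrite rmorphM; congr (_ * _).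
      exact: (rmorph_alg s).
    by ring.
  have [d Nd] := galNorm_alg galM1 (1 - b * a%:A); rewrite /galNorm Dc in Nd.
  have [a0 | nz_a] := eqVneq a 0.
    by exists 0; [apply: subring0 | rewrite Dc a0 scale0r !mul0r !subr0 scale1r].
  have nz_aM : a%:A != 0 :> M by rewrite -in_algE fmorph_eq0.
  (* The norm [d] is in [K], hence so is [c], and an integral element of [K] is in [A]. *)
  have Dc' : c = ((1 - d) / a)%:A.
    apply: (mulfI nz_aM); rewrite -in_algE -rmorphM mulrCA divff // mulr1.
    by rewrite rmorphB rmorph1 /= -Nd; ring.
  exists ((1 - d) / a); first by apply: (int_closed_alg_inv henselA (M := M)); rewrite -Dc'.
  by rewrite Dc mulrCA divff // mulr1 opprB addrCA subrr addr0.
have [nz_c Aic] := max_ideal_subr valA max_a Ac.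
have Inorm : I (galNorm 1 {:M} (1 - b * a%:A)).
  have -> : 1 - b * a%:A = i by apply: (canLR (addrK _)).
  by have [y By ->] := galNorm_cofactor henselA (BI Ii); apply: mulIr.
rewrite {}Nc in Inorm; apply: I'1.
have -> : 1 = (1 - a * c)^-1%:A * (1 - a * c)%:A :> M.
  by rewrite -in_algE -rmorphM mulVf ?rmorph1.
by apply: mulI => //; apply: int_closed_alg.
Qed.

(** By primality and stability the norm of [x] stays outside [I], so it is a unit of [A]; and [x]
    divides its norm in [B]. *)
Lemma int_closed_unit_of_stable :
  (forall s x, s \in G -> I x -> I (s x)) ->
  forall x, B x -> ~ I x -> B x^-1 /\ x != 0.
Proof.
move=> stableI x Bx I'x.
have [a Aa Na] := int_closed_galNorm henselA galM1 Bx.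
have [y By Ny] := galNorm_cofactor henselA Bx.
have I'a : ~ I a%:A.
  rewrite -Na => /maximal_ideal_prod[s Gs | s Gs Isx]; first exact: int_closed_gal.
  apply: I'x; rewrite -(gal_id {:M} x) -(mulgV s) galM ?memvf //.
  by apply: stableI; rewrite ?groupV.
have [|nz_a Aia] := unit_or_max_ideal Aa; first by move/max_ideal_above.
have nz_aM : a%:A != 0 :> M by rewrite -in_algE fmorph_eq0.
have nz_x : x != 0 by apply: contraNneq nz_aM => x0; rewrite -Na Ny x0 mul0r.
split=> //; have -> : x^-1 = a^-1%:A * y.
  apply: (mulfI nz_x); rewrite divff // mulrCA -Ny Na.
  by rewrite -in_algE -rmorphM mulVf ?rmorph1.
by apply: subringM => //; apply: int_closed_alg.
Qed.
(** The element [b1] built below is congruent to 1 modulo [I], while every automorphism outside the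
    stabilizer [Z] sends it into [I]. Once Hensel's lemma puts [b1] in [K], an [s] outside [Z] fixes
    it, and 1 falls into [I]. *)
Lemma maximal_ideal_stable s x : s \in G -> I x -> I (s x).
Proof.
pose Z := [set s in G | `[< forall x, I x -> I (s x) >]]%SET.
have ZP z : z \in Z -> z \in G /\ (forall x, I x -> I (z x)).
  by rewrite inE => /andP[Gz /asboolP Iz].
have groupZ : group_set Z.
  apply/group_setP; split=> [|y z /ZP[Gy Iy] /ZP[Gz Iz]]; rewrite inE.
    by rewrite group1; apply/asboolP=> y; rewrite gal_id.
  rewrite groupM //; apply/asboolP=> t It.
  by rewrite galM ?memvf //; apply/Iz/Iy.
pose ZG := Group groupZ.
move=> Gs Ix; apply: contrapT => I'sx.
have Z's : s \notin Z by apply/negP=> /ZP[_ /(_ x Ix)].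
(* From [y] in [I] with [g y] outside, comaximality gives [1 = i + b * g y]; take [c = b * g y]. *)
have /choice[c Dc] g : exists c, g \in G -> g \notin Z -> I (1 - c) /\ I ((g^-1)%g c).
  have [Gg | G'g] := boolP (g \in G); last by exists 0.
  have [Zg | Z'g] := boolP (g \in Z); first by exists 0.
  have [y Iy I'gy] : exists2 y, I y & ~ I (g y).
    apply: contrapT => noy; case/negP: Z'g; rewrite inE Gg; apply/asboolP=> y Iy.
    by apply: contrapT => I'gy; apply: noy; exists y.
  have Bgy : B (g y) by apply: int_closed_gal => //; apply: BI.
  have [i [b [Ii Bb D1]]] := maxI Bgy I'gy.
  exists (b * g y) => _ _; split; first by rewrite (canLR (addrK _) D1).
  rewrite rmorphM /= -[_ (g y)]galM ?memvf // mulgV gal_id.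
  by apply: mulI => //; apply: int_closed_gal; rewrite ?groupV.
pose GZ g := (g \in G) && (g \notin Z).
pose b0 := \prod_(g | GZ g) c g.
have I1b0 : I (1 - b0) by apply: prod_congr1 => g /andP[Gg Z'g]; have [] := Dc g Gg Z'g.
have Bsub1 y : I (1 - y) -> B y.
  move=> Iy; have -> : y = 1 - (1 - y) by ring.
  by apply: subringB => //; [apply: subring1 | apply/BI/Iy].
have Ib0 g : GZ g -> I (g b0).
  (* Among the factors of [b0], the one of index [g^-1] is sent into [I] by [g]. *)
  case/andP=> Gg Z'g; pose h := (g^-1)%g.
  have GZh : GZ h by rewrite /GZ groupV Gg; have:= groupV ZG g; rewrite inE /= => ->.
  have [I1ch Ich] : I (1 - c h) /\ I ((h^-1)%g (c h)) by case/andP: GZh; apply: Dc.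
  rewrite invgK in Ich; rewrite /b0 (bigD1 h) //= rmorphM; apply: mulIr => //.
  apply: int_closed_gal => //; apply: subring_prod => // k /andP[/andP[Gk Z'k] _].
  by have [/Bsub1] := Dc k Gk Z'k.
have Bb0 : B b0 by apply: Bsub1.
(* The product over [Z] makes the element invariant under [Z] and keeps both congruences. *)
pose b1 := \prod_(z in Z) z b0.
have I1b1 : I (1 - b1).
  by apply: prod_congr1 => z /ZP[Gz Iz]; rewrite -(rmorph1 z) -rmorphB; apply: Iz.
have Ib1 g : GZ g -> I (g b1).
  move=> GZg; have [Gg _] := andP GZg.
  rewrite /b1 (bigD1 1%g) ?(group1 ZG) //= gal_id rmorphM; apply: mulIr; last exact: Ib0.
  apply: int_closed_gal => //; apply: subring_prod => // z /andP[/ZP[Gz _] _].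
  exact: int_closed_gal.
have fix_b1 z : z \in Z -> z b1 = b1.
  move=> Zz; rewrite /b1 rmorph_prod [RHS](reindex_inj (mulIg z)) /=.
  by apply: eq_big => [w | w Zw]; [rewrite (groupMr w (Zz : z \in ZG)) | rewrite galM ?memvf].
have Bb1 : B b1 by apply: Bsub1.
have [r [Gr Ur Dm]] := galois_factors (sub1v _) galM1 b1 (memvf b1).
set bs := map _ r in Ur Dm; have Ibs b : b \in bs -> b = b1 \/ I b.
  case/mapP=> g /(fintype.subsetP Gr) Gg ->; have [Zg | Z'g] := boolP (g \in Z).
    by left; apply: fix_b1.
  by right; apply: Ib1; apply/andP.
have Bbs b : b \in bs -> B b by case/Ibs=> [-> | /BI].
have bs_b1 : b1 \in bs by rewrite -root_prod_XsubC -Dm root_minPoly.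
pose Q := \prod_(b <- rem b1 bs) ('X - b%:P).
have Dm' : minPoly 1 b1 = ('X - b1%:P) * Q by rewrite Dm (big_rem b1).
have IQ b : b \in rem b1 bs -> I b.
  by rewrite mem_rem_uniq // inE => /andP[/eqP b1'b /Ibs[]].
pose S := subring_pred subB.
have SP y : reflect (B y) (y \in S) by apply: asboolP.
have S_Q : Q \is a polyOver S.
  rewrite /Q big_seq rpred_prod // => b /IQ/BI/SP Sb; by rewrite polyOverXsubC.
have S_m : minPoly 1 b1 \is a polyOver S.
  by rewrite Dm' rpredM // polyOverXsubC; apply/SP.
have I1Q : I (1 - Q.[1]).
  rewrite /Q horner_prod big_seq; apply: prod_congr1 => b /IQ Ib.
  by rewrite hornerXsubC opprB addrC subrK.
have /polyOver1P[f Df] := minPolyOver 1 b1.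
have Af : coefs_in A f.
  move=> i; apply: (int_closed_alg_inv henselA (M := M)).
  by rewrite -in_algE -coef_map -Df; apply/SP/polyOverP.
have Df1 (h : {poly K}) : (h.[1])%:A = (map_poly (in_alg M) h).[1].
  by have := horner_map (in_alg M) h 1; rewrite rmorph1 => ->.
have mf1 : max_ideal A f.[1].
  apply: max_ideal_below.
    by apply: (int_closed_alg_inv henselA (M := M)); rewrite Df1 -Df; apply/SP/rpred_horner/rpred1.
  rewrite Df1 -Df Dm' hornerM hornerXsubC; apply: mulIr => //.
  by apply/SP/rpred_horner/rpred1.
have m'f1 : ~ max_ideal A (f^`()).[1].
  (* The derivative at 1 is [Q(1) + (1 - b1) * Q'(1)], congruent to 1 modulo [I] because all roots
     of [Q] lie in [I]. *)
  move=> /max_ideal_above; rewrite Df1 -deriv_map -Df Dm' derivM derivXsubC mul1r.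
  rewrite hornerD hornerM hornerXsubC => Iu; apply: I'1.
  have -> : 1 = (1 - Q.[1]) + ((Q.[1] + (1 - b1) * Q^`().[1]) - (1 - b1) * Q^`().[1]) by ring.
  apply: addI => //; apply: subI => //; apply: mulIr => //.
  by apply/SP/rpred_horner/rpred1/polyOver_deriv.
have mon_f : f \is monic by rewrite -(map_monic (in_alg M)) -Df monic_minPoly.
have [a [_ [fa0 _]]] := henselA.2 f 1 mon_f Af (subring1 subringA) mf1 m'f1.
have: a%:A \in bs.
  by rewrite -root_prod_XsubC -Dm Df /root -in_algE horner_map fa0 rmorph0.
(* The root [a] found in [K] is a conjugate of [b1], hence equal to it. *)
case/mapP=> g /(fintype.subsetP Gr) Gg Da; have b1a : b1 = a%:A.
  by rewrite -(gal_id {:M} b1) -(mulgV g) galM ?memvf // -Da; apply: rmorph_alg.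
have : I (s b1) by apply: Ib1; apply/andP.
rewrite b1a (rmorph_alg s) -b1a => Isb1; apply: I'1.
have -> : 1 = (1 - b1) + b1 by ring.
exact: addI.
Qed.
End MaximalIdeal.

(** Elements of [B] outside a stable maximal ideal are units, and [r], [s] with [r - s = 1] cannot
    both lie in the ideal. *)
Theorem int_closed_valuation_ring (K : fieldType) (A : K -> Prop) (M : splittingFieldType K) :
  is_henselian_valuation_ring A -> galois 1 {:M} ->
  is_valuation_ring (@integral_closure K M A).
Proof.
move=> henselA galM1; have subA := henselA.1.1.
have [I [idealI I0 maxI]] := maximal_proper_ideal (int_closed_subring M subA).
apply: local_int_closed_valuation => // r s Br Bs rs1.
have unitB := int_closed_unit_of_stable henselA galM1 idealI maxI
  (maximal_ideal_stable henselA galM1 idealI I0 maxI).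
have [Ir | I'r] := pselect (I r); last by left; apply: unitB.
right; apply: unitB => // Is; have [_ addI mulI []] := idealI.
rewrite -rs1 -mulN1r; apply: addI => //; apply: mulI => //.
by apply: subringN; [apply: int_closed_subring | apply: subring1; apply: int_closed_subring].
Qed.

(** * Construction of splitting fields *)

Lemma irreducible_divisor (F : fieldType) (p : {poly F}) : (1 < size p)%N ->
  exists2 r, r %| p & irreducible_poly r.
Proof.
move=> p_gt1; pose P n := `[< exists2 r, r %| p & size r = n /\ (1 < n)%N >].
have exP : exists n, P n by exists (size p); apply/asboolP; exists p.
have nz_p : p != 0 by rewrite -size_poly_gt0 ltnW.
case: (ex_minnP exP) => n /asboolP[r r_p [Dn n_gt1]] min_n.
exists r => //; split=> [|q q_n1 q_r]; first by rewrite Dn.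
have nz_r : r != 0 by rewrite -size_poly_gt0 Dn ltnW.
have nz_q : q != 0 by apply: dvdpN0 nz_r.
rewrite -dvdp_size_eqp // eqn_leq dvdp_leq //= Dn min_n //; apply/asboolP.
exists q; first exact: dvdp_trans r_p.
by rewrite ltn_neqAle eq_sym q_n1 size_poly_gt0.
Qed.

(** Induction on the size, for all base fields at once: adjoin a root of an irreducible factor, then
    split the quotient over the larger field. *)
Lemma exists_split_ext n (F : fieldType) (p : {poly F}) : (size p <= n)%N -> p != 0 ->
  exists (N : fieldExtType F) (zs : seq N),
    map_poly (in_alg N) p %= \prod_(z <- zs) ('X - z%:P).
Proof.
elim: n F p => [|n IHn] F p.
  by rewrite leqn0 size_poly_eq0 => /eqP->; rewrite eqxx.
move=> le_p_n nz_p; have [p_le1 | p_gt1] := leqP (size p) 1.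
  exists F^o, [::].
  by rewrite big_nil -size_poly_eq1 size_map_poly eqn_leq p_le1 size_poly_gt0.
have [r r_p irr_r] := irreducible_divisor p_gt1.
have [E _ [x rx0 _]] := irredp_FAdjoin irr_r.
have /factor_theorem[q Dp] : root (map_poly (in_alg E) p) x.
  by rewrite -(divpK r_p) rmorphM rootM rx0 orbT.
have nz_q : q != 0.
  by apply: contraNneq nz_p => q0; rewrite -(map_poly_eq0 (in_alg E)) Dp q0 mul0r.
have le_q_n : (size q <= n)%N.
  rewrite -ltnS (leq_trans _ le_p_n) // -(size_map_poly (in_alg E)) Dp.
  by rewrite size_mul ?polyXsubC_eq0 // size_XsubC addn2.
have [N [zs Dq]] := IHn E q le_q_n nz_q.
(* [baseFieldType N] is the extension [N] of [E] regarded as an extension of [F]. *)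
exists (baseFieldType N), (x%:A :: zs).
have -> : map_poly (in_alg (baseFieldType N)) p
    = map_poly (in_alg N) (map_poly (in_alg E) p).
  rewrite -map_poly_comp; apply: eq_map_poly => a /=.
  exact: (baseField_scaleE a 1).
by rewrite Dp big_cons mulrC rmorphM /= map_polyXsubC eqp_mull.
Qed.

(** The extension just built may be too large, so it is cut down to the subfield generated by the
    roots. *)
Lemma exists_splitting_field (F : fieldType) (p : {poly F}) : p != 0 ->
  exists (M : splittingFieldType F) (zs : seq M),
    map_poly (in_alg M) p %= \prod_(z <- zs) ('X - z%:P).
Proof.
move=> nz_p; have [N [ys Dp]] := exists_split_ext (leqnn _) nz_p.
pose E := subvs_of <<1 & ys>>; pose toN := linfun (vsval : E -> N).
have [zs Dys] : exists zs, map toN zs = ys.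
  exists (map (vsproj _) ys); rewrite -map_comp map_id_in // => y ys_y.
  by rewrite /= lfunE /= vsprojK ?seqv_sub_adjoin.
have splitE : map_poly (in_alg E) p %= \prod_(z <- zs) ('X - z%:P).
  have Dprod : \prod_(z <- ys) ('X - z%:P) = map_poly toN (\prod_(z <- zs) ('X - z%:P)).
    transitivity (\prod_(z <- map toN zs) ('X - z%:P)); first by rewrite Dys.
    by rewrite big_map rmorph_prod; apply: eq_bigr => z _; rewrite /= map_polyXsubC.
  have Dpoly : map_poly (in_alg N) p = map_poly toN (map_poly (in_alg E) p).
    by rewrite -map_poly_comp; apply: eq_map_poly => a /=; rewrite rmorph_alg.
  by rewrite -(eqp_map toN) -Dprod -Dpoly.
have axE : SplittingField.axiom E.
  exists (map_poly (in_alg E) p); first by apply/polyOver1P; exists p.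
  exists zs => //; apply/vspaceP=> u; rewrite memvf.
  have: toN u \in (toN @: <<1 & zs>>)%VS.
    by rewrite aimg_adjoin_seq aimg1 Dys lfunE (valP u).
  by case/memv_imgP=> v zs_v; rewrite !lfunE => /val_inj->.
pose splitEmixin := FieldExt_isSplittingField.Build F E axE.
pose M : splittingFieldType F := HB.pack E splitEmixin.
by exists M, zs.
Qed.

Lemma pchar0_galois (K : fieldType) (M : splittingFieldType K) :
  [pchar K] =i pred0 -> galois 1 {:M}.
Proof.
move=> K0; apply/and3P; split; [exact: sub1v | | exact: normalFieldf].
apply/separableP=> y _; apply: pcharf0_separable => i.
by rewrite pchar_lalg K0.
Qed.

Lemma galX_fix (K : fieldType) (M : splittingFieldType K) (s : gal_of {:M}) x n :
  s x = x -> (s ^+ n)%g x = x.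
Proof.
by move=> sx; elim: n => [|n IHn]; rewrite ?expg0 ?gal_id // expgS galM ?memvf // sx.
Qed.

Lemma galX_eigen (K : fieldType) (M : splittingFieldType K) (s : gal_of {:M}) x (z : K) n :
  s x = z%:A * x -> (s ^+ n)%g x = (z ^+ n)%:A * x.
Proof.
move=> sx; elim: n => [|n IHn]; first by rewrite expg0 gal_id expr0 scale1r mul1r.
rewrite expgSr galM ?memvf // IHn rmorphM /= (rmorph_alg s) sx mulrA.
by rewrite -!in_algE -rmorphM exprSr.
Qed.

(** * Comparison of values in a Galois extension *)

Section HenselianGalois.
Variables (K : fieldType) (A : K -> Prop) (M : splittingFieldType K).
Hypotheses (henselA : is_henselian_valuation_ring A) (galM1 : galois 1 {:M}).
Let valA : is_valuation_ring A := henselA.1.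
Let subringA : is_subring A := valA.1.
Local Notation B := (@integral_closure K M A).
Local Notation G := ('Gal({:M} / 1%VS))%g.
Let valB : is_valuation_ring B := int_closed_valuation_ring henselA galM1.
Let subB : is_subring B := valB.1.

(** If [1/x] is integral instead, then [x] is its norm times the product of the other conjugates of
    [1/x]. *)
Lemma galNorm_int_closed x a : A a -> galNorm 1 {:M} x = a%:A -> B x.
Proof.
move=> Aa Nx; have [-> | nz_x] := eqVneq x 0; first exact: subring0.
have [// | Bxi] := valB.2 x nz_x.
have [y By Ny] := galNorm_cofactor henselA Bxi.
have Dx : galNorm 1 {:M} x * galNorm 1 {:M} x^-1 = 1.
  by rewrite -galNormM divff // galNorm1.
rewrite -[x]mulr1 -Dx Nx Ny mulrCA mulVKf //.
by apply: subringM => //; apply: int_closed_alg.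
Qed.

(** Conjugate elements have the same value, as their quotient has norm 1. *)
Lemma gal_div_int_closed s x : s \in G -> B (s x / x).
Proof.
move=> Gs; have [-> | nz_x] := eqVneq x 0.
  by rewrite rmorph0 mul0r; apply: subring0.
apply: (galNorm_int_closed (subring1 subringA)).
by rewrite galNormM galNormV galNorm_gal ?memvf ?sub1v // divff ?galNorm_eq0 // scale1r.
Qed.

Lemma prod_sub1_dvd (I : eqType) (r : seq I) (f : I -> M) d :
    (forall i, i \in r -> B (f i) /\ exists2 w, B w & f i - 1 = d * w) ->
  exists2 w, B w & \prod_(i <- r) f i - 1 = d * w.
Proof.
elim: r => [|i r IHr] rP.
  by exists 0; [apply: subring0 | rewrite big_nil subrr mulr0].
have [|w Bw Dw] := IHr; first by move=> j r_j; apply: rP; rewrite inE r_j orbT.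
have [|Bfi [v Bv Dv]] := rP i; first exact: mem_head.
exists (f i * w + v); first by apply: subringD => //; apply: subringM.
by rewrite big_cons mulrDr -Dv mulrCA -Dw; ring.
Qed.

(** * Approximation of [al] from [K]; [rs] stands for the roots of a polynomial of degree below
    [p] *)

Variables (p : nat) (tau : gal_of {:M}) (al : M) (rs : seq M).
Hypotheses (max_p : max_ideal A p%:R) (p_pr : prime p) (Gtau : tau \in G).
Hypotheses (tau_al : tau al != al).
Hypothesis orbit_al : forall s, s \in G -> exists i, s al = (tau ^+ i)%g al.
Hypotheses (lt_rs_p : (size rs < p)%N) (fix_rs : forall b, b \in rs -> tau b = b).
Hypothesis stable_rs : forall s b, s \in G -> b \in rs -> s b \in rs.

Let nz_alB b : b \in rs -> al - b != 0.
Proof.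
by move=> rs_b; apply: contra tau_al; rewrite subr_eq0 => /eqP->; rewrite fix_rs.
Qed.

(* The Galois conjugates of [b] over [K(al)] are all as close to [al] as [b],
   and there are fewer than [p] of them, so that their average is too. *)
Lemma approx_in_base b : b \in rs -> exists a, B ((al - a%:A) / (al - b)).
Proof.
move=> rs_b; pose E := <<1; al>>%AS.
have galME : galois E {:M} by apply: galoisS galM1; rewrite sub1v subvf.
have [r [Er Ur Dm]] := galois_factors (subvf _) galME b (memvf b).
set bs := map _ r in Ur Dm.
have rP s : s \in r -> s \in G /\ s al = al.
  move=> /(fintype.subsetP Er) Es; split; last first.
    by apply: fixed_gal Es _; rewrite ?subvf ?memv_adjoin.
  by apply: fintype.subsetP Es; apply: galS; apply: sub1v.
have sub_bs : {subset bs <= rs} by move=> _ /mapP[s /rP[Gs _] ->]; apply: stable_rs.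
have le_bs_p : (size bs < p)%N by apply: leq_ltn_trans lt_rs_p; apply: uniq_leq_size.
have bs_b : b \in bs by rewrite -root_prod_XsubC -Dm root_minPoly.
have bs_gt0 : (0 < size bs)%N by case: (bs) bs_b.
have [nz_n An] : (size bs)%:R != 0 :> K /\ A (size bs)%:R^-1.
  apply: (coprime_val_unit valA max_p); rewrite prime_coprime //.
  by apply/negP=> /(dvdn_leq bs_gt0); rewrite leqNgt le_bs_p.
set n := (size bs)%:R in nz_n An; pose a1 := \sum_(c <- bs) c.
have Ea1 : a1 \in E.
  rewrite -[a1]opprK -coefPn_prod_XsubC -?lt0n // -Dm rpredN.
  exact: (polyOverP (minPolyOver _ _)).
have tau_a1 : tau a1 = a1.
  rewrite rmorph_sum; apply: eq_big_seq => c /sub_bs; exact: fix_rs.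
(* The sum [a1] lies in [K(al)], so an automorphism acts on it through its effect on [al], which is
   that of a power of [tau]; and [tau] fixes [a1] because it fixes [rs]. *)
have [a2 Da1] : exists a2, a1 = a2%:A.
  apply: fixed_alg => // s Gs; have /Fadjoin_polyP[q q1 Da1] := Ea1.
  have Ds t : t \in G -> t a1 = q.[t al].
    by move=> Gt; rewrite Da1 -horner_map /= (fixedPoly_gal (sub1v _) Gt q1).
  have [i Di] := orbit_al Gs; rewrite Ds // Di -Ds ?groupX //.
  exact: galX_fix.
exists (n^-1 * a2).
have -> : (al - (n^-1 * a2)%:A) / (al - b)
    = n^-1%:A * \sum_(c <- bs) (al - c) / (al - b).
  rewrite -mulr_suml mulrA; congr (_ / _).
  rewrite sumrB -/a1 Da1 big_const_seq count_predT iter_addr_0 -mulr_natl.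
  rewrite mulrBr mulrA -(rmorph_nat (in_alg M)) -!in_algE -!rmorphM.
  by rewrite mulVf // rmorph1 mul1r.
apply: subringM => //; first exact: int_closed_alg.
rewrite big_map big_seq; apply: subring_sum => // s r_s.
by have [Gs {1}<-] := rP s r_s; rewrite -rmorphB; apply: gal_div_int_closed.
Qed.

Lemma kummer_difference_bound (l : K) (c := l%:A * \prod_(b <- rs) (al - b)) : l != 0 ->
  exists a : K, B ((tau c / c - 1) * (al - a%:A) / (tau al - al)).
Proof.
move=> nz_l; have nz_lM : l%:A != 0 :> M by rewrite -in_algE fmorph_eq0.
pose f b := tau (al - b) / (al - b).
have Dc : tau c / c = \prod_(b <- rs) f b.
  rewrite /c rmorphM /= (rmorph_alg tau) invfM mulrACA divff // mul1r.
  by rewrite rmorph_prod -prodfV -big_split.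
have [rs0 | [b0 rs_b0]] : rs = [::] \/ exists b, b \in rs.
  case: (rs) => [|b s]; [by left | by right; exists b; apply: mem_head].
  by exists 0; rewrite Dc rs0 big_nil subrr !mul0r; apply: subring0.
(* Least value of [1 / (al - b)] means that [b] is a root closest to [al]. *)
have [|d /mapP[b rs_b ->] [_ minb]] :=
    valuation_min_seq valB (map_f (fun b => (al - b)^-1) rs_b0).
  by rewrite invr_eq0 nz_alB.
have [a Ba] := approx_in_base rs_b.
(* Since [tau] fixes each root, [f i - 1 = (tau al - al) / (al - i)], a multiple of the same
   expression at [b]; so the product of the [f i] is 1 modulo the latter. *)
have [i rs_i | w Bw Dw] := @prod_sub1_dvd _ rs f ((tau al - al) / (al - b)).
  split; first exact: gal_div_int_closed.
  exists ((al - b) / (al - i)).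
    by have := minb _ (map_f _ rs_i); rewrite invrK mulrC.
  rewrite mulrA divfK ?nz_alB // /f rmorphB /= (fix_rs rs_i).
  by apply: (canRL (mulfK (nz_alB rs_i))); rewrite mulrBl divfK ?nz_alB // mul1r; ring.
exists a; rewrite Dc Dw.
have -> : (tau al - al) / (al - b) * w * (al - a%:A) / (tau al - al)
    = w * ((al - a%:A) / (al - b)).
  by field; rewrite nz_alB // subr_eq0 tau_al.
exact: subringM.
Qed.
End HenselianGalois.

(** By pigeonhole the orbit of [b] under [s] has a period at most [n], and this divides the
    factorial of [n]. *)
Lemma galX_fact_fix (K : fieldType) (M : splittingFieldType K) (s : gal_of {:M})
    (rs : seq M) n b :
  (forall c, c \in rs -> s c \in rs) -> (size rs <= n)%N -> b \in rs ->
  (s ^+ n`!)%g b = b.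
Proof.
move=> stable_rs le_rs_n rs_b.
have rs_sb i : (s ^+ i)%g b \in rs.
  elim: i => [|i IHi]; first by rewrite expg0 gal_id.
  by rewrite expgSr galM ?memvf //; apply: stable_rs.
pose t := mkseq (fun i => (s ^+ i)%g b) n.+1.
have sub_t : {subset t <= rs} by move=> _ /mapP[i _ ->].
have /(uniqPn 0)[i [j [lt_ij]]] : ~~ uniq t.
  by apply/negP=> /uniq_leq_size/(_ sub_t); rewrite size_mkseq leqNgt ltnS le_rs_n.
rewrite size_mkseq => lt_jn; rewrite !nth_mkseq ?(ltn_trans lt_ij) // => Dij.
have fix_d : (s ^+ (j - i))%g b = b.
  apply: (fmorph_inj (s ^+ i)%g).
  by rewrite -[LHS]galM ?memvf // -expgD subnK ?(ltnW lt_ij).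
have /dvdnP[q ->] : (j - i %| n`!)%N.
  by rewrite dvdn_fact // subn_gt0 lt_ij (leq_trans (leq_subr _ _)) // -ltnS.
by rewrite mulnC expgM galX_fix.
Qed.

Lemma coprime_fact p n : prime p -> (n < p)%N -> coprime p n`!.
Proof.
move=> p_pr; elim: n => [|n IHn] lt_n_p; first by rewrite fact0 coprimen1.
by rewrite factS coprimeMr IHn ?(ltnW lt_n_p) // prime_coprime // gtnNdvd.
Qed.

(** * The bound over a field where the polynomial splits *)

Section KummerBound.
Variables (K : fieldType) (A : K -> Prop) (p : nat) (zeta h0 : K).
Hypotheses (henselA : is_henselian_valuation_ring A) (char0 : [pchar K] =i pred0).
Hypotheses (p_pr : prime p) (max_p : max_ideal A p%:R).
Hypothesis prim_z : p.-primitive_root zeta.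
Hypothesis nz_h0 : h0 != 0.

Lemma zeta_neq1 : zeta != 1.
Proof.
rewrite -[zeta]expr1 -(prim_order_dvd prim_z) dvdn1.
by case: eqP (prime_gt1 p_pr) => // ->.
Qed.

Section Eigen.
Variables (M : splittingFieldType K).
Local Notation G := ('Gal({:M} / 1%VS))%g.

Lemma gal_kummer_root (x : M) h s : h != 0 -> x ^+ p = h%:A -> s \in G ->
  exists i, s x = (zeta ^+ i)%:A * x.
Proof.
move=> nz_h Dh Gs.
have nz_x : x != 0.
  apply: contraNneq nz_h => x0; move: Dh.
  by rewrite x0 expr0n gtn_eqF ?prime_gt0 // -in_algE => /esym/eqP; rewrite fmorph_eq0.
have prim_zM : p.-primitive_root (in_alg M zeta) by rewrite fmorph_primitive_root.
have [|i Di] := prim_rootP prim_zM (_ : (s x / x) ^+ p = 1).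
  by rewrite expr_div_n -rmorphXn Dh /= (rmorph_alg s) -Dh divff // expf_neq0.
by exists i; rewrite -in_algE rmorphXn /= -Di divfK.
Qed.

(** To get [tau], take [s0] moving [al], say to [zeta ^ j * al] with [j] prime to [p]. Its power of
    exponent [(p-1)!] fixes the fewer than [p] roots and multiplies [al] by [zeta ^ m], with
    [m = (p-1)! * j] still prime to [p]. Raising to an inverse [u] of [m] modulo [p] turns the
    multiplier into [zeta]. *)
Lemma kummer_bound_split (al : M) (g : {poly K}) (zs : seq M) :
  al ^+ p = h0%:A -> al \notin 1%VS ->
  map_poly (in_alg M) g %= \prod_(z <- zs) ('X - z%:P) -> (size g <= p)%N -> g != 0 ->
  let ev x := (map_poly (in_alg M) g).[x] in
  exists a, integral_closure A
    ((ev (zeta%:A * al) / ev al - 1) * (al - a%:A) / (zeta%:A * al - al)).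
Proof.
move=> Dh0 al'K splits_g le_g_p nz_g ev.
have galM1 : galois 1 {:M} := pchar0_galois M char0.
have zsP b : b \in zs = root (map_poly (in_alg M) g) b.
  by rewrite (eqp_root splits_g) root_prod_XsubC.
have lt_zs_p : (size zs < p)%N.
  by rewrite -(size_prod_XsubC _ id) -(eqp_size splits_g) size_map_poly.
have Galg (s : gal_of {:M}) : map_poly s (map_poly (in_alg M) g) = map_poly (in_alg M) g.
  by rewrite -map_poly_comp; apply: eq_map_poly => a /=; rewrite rmorph_alg.
have stable_zs (s : gal_of {:M}) b : s \in G -> b \in zs -> s b \in zs.
  by move=> _; rewrite !zsP -{2}(Galg s) fmorph_root.
have [s0 Gs0 s0_al] : exists2 s, s \in G & s al != al.
  apply: contrapT => fix_al; case/negP: al'K; apply/vlineP.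
  apply: fixed_alg => // s Gs; apply: contrapT => /eqP s_al.
  by apply: fix_al; exists s.
have [j Dj] := gal_kummer_root nz_h0 Dh0 Gs0.
have co_pj : coprime p j.
  rewrite prime_coprime //; apply: contra s0_al => /dvdnP[q Dq].
  by rewrite Dj Dq mulnC exprM (prim_expr_order prim_z) expr1n scale1r mul1r.
pose m := ((p.-1)`! * j)%N.
have p_gt1 := prime_gt1 p_pr.
have m_gt0 : (0 < m)%N.
  rewrite muln_gt0 fact_gt0; case: (j) co_pj => //.
  by rewrite /coprime gcdn0; case: eqP p_gt1 => // ->.
have [u v Duv _] := egcdnP p m_gt0.
have {}Duv : (u * m = v * p + 1)%N.
  rewrite Duv; congr (_ + _)%N; apply/eqP; rewrite gcdnC.
  by rewrite -/(coprime _ _) /m coprimeMr co_pj coprime_fact // prednK ?prime_gt0.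
pose tau := (s0 ^+ (p.-1)`! ^+ u)%g.
have Gtau : tau \in G by rewrite !groupX.
have tau_al : tau al = zeta%:A * al.
  rewrite /tau -expgM (galX_eigen _ Dj) -exprM mulnA mulnC (mulnC j) Duv.
  by rewrite addn1 exprSr mulnC exprM (prim_expr_order prim_z) expr1n mul1r.
have tau'al : tau al != al.
  rewrite tau_al -subr_eq0 -{2}[al]mul1r -mulrBl mulf_eq0 subr_eq0 negb_or.
  rewrite -in_algE fmorph_eq1 zeta_neq1 /=.
  by apply: contraNneq al'K => ->; apply: mem0v.
have fix_zs b : b \in zs -> tau b = b.
  move=> zs_b; apply: galX_fix; apply: (@galX_fact_fix _ _ _ zs) => // [c|].
    exact: stable_zs.
  by rewrite -ltnS prednK ?prime_gt0.
have orbit_al s : s \in G -> exists i, s al = (tau ^+ i)%g al.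
  move=> Gs; have [i Di] := gal_kummer_root nz_h0 Dh0 Gs; exists i.
  by rewrite (galX_eigen _ tau_al).
have nz_l : lead_coef g != 0 by rewrite lead_coef_eq0.
have [a Ba] := kummer_difference_bound henselA galM1 max_p p_pr Gtau tau'al orbit_al
  lt_zs_p fix_zs stable_zs nz_l.
exists a; move: Ba; rewrite -tau_al.
have -> : (lead_coef g)%:A * \prod_(b <- zs) (al - b) = ev al.
  have /eqpf_eq[k nz_k Dg] := splits_g.
  have <- : k = (lead_coef g)%:A.
    rewrite -in_algE -lead_coef_map Dg lead_coefZ.
    by rewrite (monicP (monic_prod_XsubC _ _ _)) mulr1.
  rewrite /ev Dg hornerZ horner_prod; congr (_ * _).
  by apply: eq_bigr => b _; rewrite hornerXsubC.
by have -> : tau (ev al) = ev (tau al) by rewrite /ev -[in RHS](Galg tau) horner_map.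
Qed.
End Eigen.
End KummerBound.

(** * Transfer between [alpha] and a conjugate in another extension *)

Section KummerGenerator.
Variables (K : fieldType) (L : splittingFieldType K) (p : nat) (h0 : K) (alpha : L).
Hypotheses (p_pr : prime p) (Dh0 : alpha ^+ p = h0%:A).
Hypothesis gen_alpha : <<1; alpha>>%VS = fullv.
Local Notation ev P x := (map_poly (in_alg _) P).[x].

Lemma kummer_poly_neq0 (R : nzRingType) (a : R) : 'X^p - a%:P != 0 :> {poly R}.
Proof. by rewrite -size_poly_eq0 size_XnsubC ?prime_gt0. Qed.

Lemma kummer_minPoly_dvd : minPoly 1 alpha %| 'X^p - (h0%:A)%:P.
Proof.
apply: minPoly_dvdp; last by rewrite /root !hornerE Dh0 subrr.
by rewrite rpredB ?rpredX ?polyOverX // polyOverC; apply/vlineP; exists h0.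
Qed.

Lemma kummer_poly_gen x : exists2 P : {poly K}, (size P <= p)%N & x = ev P alpha.
Proof.
have := Fadjoin_polyOver 1 alpha x => /polyOver1P[P DP]; exists P.
  rewrite -(size_map_poly (in_alg L)) -DP (leq_trans (size_Fadjoin_poly _ _ _)) //.
  rewrite -ltnS -size_minPoly -(size_XnsubC (h0%:A : L) (prime_gt0 p_pr)).
  by rewrite dvdp_leq ?kummer_poly_neq0 ?kummer_minPoly_dvd.
by rewrite -DP Fadjoin_poly_eq // gen_alpha memvf.
Qed.

(* [al] is a conjugate of [alpha] in another extension, and satisfies the same
   polynomial relations over [K]. *)
Variables (M : splittingFieldType K) (m : {poly K}) (al : M).
Hypotheses (Dm : minPoly 1 alpha = map_poly (in_alg L) m) (m_al : ev m al = 0).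

Lemma conjugate_relation (P : {poly K}) : ev P alpha = 0 <-> ev P al = 0.
Proof.
have to_al Q : ev Q alpha = 0 -> ev Q al = 0.
  move=> Q0; have: minPoly 1 alpha %| map_poly (in_alg L) Q.
    by apply: minPoly_dvdp; [apply/polyOver1P; exists Q | apply/eqP].
  rewrite Dm dvdp_map => /dvdpP[q ->].
  by rewrite rmorphM hornerM m_al mulr0.
split=> [|P0]; first exact: to_al; apply/eqP; apply: contraTT isT => nzP.
(* For the converse, a nonzero [P(alpha)] has an inverse [Q(alpha)], and the relation
   [P * Q - 1 = 0] carried to [al] contradicts [P(al) = 0]. *)
have [Q _ DQ] := kummer_poly_gen (ev P alpha)^-1.
have /to_al : ev (P * Q - 1) alpha = 0.
  by rewrite rmorphB rmorphM rmorph1 hornerD hornerN hornerM hornerC -DQ divff ?subrr.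
rewrite rmorphB rmorphM rmorph1 hornerD hornerN hornerM hornerC P0 mul0r sub0r.
by move/eqP; rewrite oppr_eq0 oner_eq0.
Qed.

Lemma conjugate_kummer : al ^+ p = h0%:A.
Proof.
have /conjugate_relation : ev ('X^p - h0%:P) alpha = 0.
  by rewrite rmorphB /= map_polyXn map_polyC !hornerE Dh0 subrr.
by rewrite rmorphB /= map_polyXn map_polyC !hornerE => /eqP; rewrite subr_eq0 => /eqP.
Qed.

Lemma conjugate_notin_base : alpha \notin 1%VS -> al \notin 1%VS.
Proof.
apply: contra => /vlineP[a Da]; apply/vlineP; exists a.
have /conjugate_relation : ev ('X - a%:P) al = 0.
  by rewrite map_polyXsubC hornerXsubC Da subrr.
by rewrite map_polyXsubC hornerXsubC => /eqP; rewrite subr_eq0 => /eqP.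
Qed.

(** The quotient at [alpha] is a polynomial value [W(alpha)], and [W(al)] is the quotient at [al]. A
    monic equation for it is then the polynomial relation [f(W) = 0], which transfers. *)
Lemma conjugate_int_closed (A : K -> Prop) (N1 D : {poly K}) :
  ev D alpha != 0 ->
  integral_closure A (ev N1 al / ev D al) -> integral_closure A (ev N1 alpha / ev D alpha).
Proof.
move=> nz_D [f [mon_f [Af fx0]]]; exists f; split=> //; split=> //.
have nz_Dal : ev D al != 0 by apply: contra nz_D => /eqP/conjugate_relation->.
have [W _ DW] := kummer_poly_gen (ev N1 alpha / ev D alpha).
have /conjugate_relation : ev (W * D - N1) alpha = 0.
  by rewrite rmorphB rmorphM hornerD hornerN hornerM -DW divfK // subrr.
rewrite rmorphB rmorphM hornerD hornerN hornerM => /eqP; rewrite subr_eq0 => /eqP DN1.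
rewrite -DN1 mulfK // /root -horner_comp -map_comp_poly in fx0.
by rewrite DW /root -horner_comp -map_comp_poly; apply/eqP/conjugate_relation/eqP.
Qed.
End KummerGenerator.

(** * The bound in [L] itself *)

Section KummerBoundExt.
Variables (K : fieldType) (A : K -> Prop) (L : splittingFieldType K).
Variables (p : nat) (zeta h0 : K) (alpha : L) (sigma : gal_of {:L}).
Hypotheses (henselA : is_henselian_valuation_ring A) (char0 : [pchar K] =i pred0).
Hypotheses (p_pr : prime p) (max_p : max_ideal A p%:R).
Hypothesis prim_z : p.-primitive_root zeta.
Hypotheses (nz_h0 : h0 != 0) (Dh0 : alpha ^+ p = h0%:A).
Hypotheses (gen_alpha : <<1; alpha>>%VS = fullv) (alpha'K : alpha \notin 1%VS).
Hypothesis sigma_alpha : sigma alpha = zeta%:A * alpha.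
Local Notation ev P x := (map_poly (in_alg _) P).[x].

Lemma kummer_difference_bound_ext b : b != 0 ->
  exists a, integral_closure A
    ((sigma b / b - 1) * (alpha - a%:A) / (zeta%:A * alpha - alpha)).
Proof.
move=> nz_b; have [g le_g_p Dg] := kummer_poly_gen p_pr Dh0 gen_alpha b.
have nz_g : g != 0 by apply: contraNneq nz_b => g0; rewrite Dg g0 rmorph0 horner0.
have /polyOver1P[m Dm] := minPolyOver 1 alpha.
have mon_m : m \is monic by rewrite -(map_monic (in_alg L)) -Dm monic_minPoly.
(* Including [m] provides, next to the roots of [g], a conjugate [al] of [alpha] in [M]. *)
have [M [zs Dzs]] := exists_splitting_field (mulf_neq0 (monic_neq0 mon_m) nz_g).
have splitP q : q %| m * g ->
    exists ys : seq M, map_poly (in_alg M) q %= \prod_(z <- ys) ('X - z%:P).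
  rewrite -(dvdp_map (in_alg M)) (eqp_dvdr _ Dzs) => /dvdp_prod_XsubC[k Dq].
  by exists (mask k zs).
have [|[|al ys] Dys] := splitP m; first exact: dvdp_mulr.
  have: (1 < size (minPoly 1 alpha))%N by rewrite size_minPoly.
  by rewrite Dm size_map_poly -(size_map_poly (in_alg M)) (eqp_size Dys) big_nil size_poly1.
have m_al : ev m al = 0.
  by apply/eqP; rewrite -/(root _ _) (eqp_root Dys) root_prod_XsubC mem_head.
have [|gs Dgs] := splitP g; first exact: dvdp_mull.
have Dal := conjugate_kummer p_pr Dh0 gen_alpha Dm m_al.
have al'K := conjugate_notin_base p_pr Dh0 gen_alpha Dm m_al alpha'K.
have [a Ba] := kummer_bound_split henselA char0 p_pr max_p prim_z nz_h0 Dal al'K Dgs le_g_p nz_g.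
(* With [gz] the polynomial [g(zeta X)], the element to bound is [N / D] evaluated at [alpha], the
   form in which integrality comes back from [al]. *)
exists a; pose gz := g \Po (zeta *: 'X).
pose N := (gz - g) * ('X - a%:P); pose D := g * ((zeta - 1) *: 'X).
have evN (E : splittingFieldType K) (x : E) :
    ev N x = (ev g (zeta%:A * x) - ev g x) * (x - a%:A).
  rewrite /N /gz !(rmorphM, rmorphB) /= map_comp_poly map_polyZ !map_polyX map_polyC /=.
  by rewrite !hornerE horner_comp !hornerE.
have evD (E : splittingFieldType K) (x : E) : ev D x = ev g x * (zeta%:A * x - x).
  rewrite /D rmorphM /= map_polyZ map_polyX /= !hornerE.
  by rewrite scalerBl scale1r -[LHS]mulrA mulrBl mul1r.
have DB (E : splittingFieldType K) (x : E) : ev g x != 0 ->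
    ev N x / ev D x = (ev g (zeta%:A * x) / ev g x - 1) * (x - a%:A) / (zeta%:A * x - x).
  move=> nz_gx; rewrite evN evD invfM mulrA; congr (_ / _).
  by rewrite mulrAC; congr (_ * _); rewrite mulrBl divff.
have Dsb : sigma b = ev g (zeta%:A * alpha).
  rewrite Dg -sigma_alpha -horner_map -map_poly_comp.
  by congr _.[_]; apply: eq_map_poly => k /=; rewrite rmorph_alg.
have nz_gL : ev g alpha != 0 by rewrite -Dg.
have nz_gM : ev g al != 0.
  by apply: contra nz_gL => /eqP/(conjugate_relation p_pr Dh0 gen_alpha Dm m_al)->.
rewrite Dsb Dg -DB //.
apply: (conjugate_int_closed p_pr Dh0 gen_alpha Dm m_al); last by rewrite DB.
rewrite evD mulf_neq0 // -{2}[alpha]mul1r -mulrBl mulf_neq0 //.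
  by rewrite subr_eq0 -in_algE fmorph_eq1 (zeta_neq1 p_pr prim_z).
by apply: contraNneq alpha'K => ->; apply: mem0v.
Qed.
End KummerBoundExt.

(** * Generated ideals *)

Section GeneratedIdeal.
Variables (K : fieldType) (A : K -> Prop).
Hypothesis subringA : is_subring A.

Lemma gen_by_scale (S : K -> Prop) a x : A a -> S x -> gen_by A S (a * x).
Proof.
by move=> Aa Sx; exists 1%N, (fun=> a), (fun=> x); rewrite big_ord1.
Qed.

Lemma gen_by_sum (S : K -> Prop) n (F : 'I_n -> K) :
  (forall i, gen_by A S (F i)) -> gen_by A S (\sum_i F i).
Proof.
move=> SF; elim/big_rec: _ => [|i x _ [n2 [r2 [s2 [Ar2 [Ss2 ->]]]]]].
  by exists 0%N, (fun=> 0), (fun=> 0); rewrite big_ord0; split=> [[] | ] //; split=> [[]|].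
have [n1 [r1 [s1 [Ar1 [Ss1 ->]]]]] := SF i.
pose glue (f1 : 'I_n1 -> K) (f2 : 'I_n2 -> K) (k : 'I_(n1 + n2)) :=
  match split k with inl k1 => f1 k1 | inr k2 => f2 k2 end.
exists (n1 + n2)%N, (glue r1 r2), (glue s1 s2); split; last split.
- by rewrite /glue => k; case: split.
- by rewrite /glue => k; case: split.
rewrite big_split_ord; congr (_ + _); apply: eq_bigr => k _; rewrite /glue.
  by rewrite (unsplitK (inl k)).
by rewrite (unsplitK (inr k)).
Qed.

Lemma gen_by_sub (S S' : K -> Prop) x :
  (forall y, S y -> gen_by A S' y) -> gen_by A S x -> gen_by A S' x.
Proof.
move=> SS' [n [r [s [Ar [Ss ->]]]]]; apply: gen_by_sum => i.
have [m [r' [s' [Ar' [Ss' ->]]]]] := SS' _ (Ss i).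
rewrite mulr_sumr; apply: gen_by_sum => j; rewrite mulrA.
by apply: gen_by_scale => //; apply: subringM.
Qed.
End GeneratedIdeal.

(** * Norms in the Kummer extension *)

Section KummerNorm.
Variables (K : fieldType) (L : splittingFieldType K).
Variables (p : nat) (zeta h0 : K) (alpha : L) (sigma : gal_of {:L}).
Hypotheses (p_pr : prime p) (prim_z : p.-primitive_root zeta).
Hypotheses (nz_h0 : h0 != 0) (Dh0 : alpha ^+ p = h0%:A).
Hypotheses (gen_alpha : <<1; alpha>>%VS = fullv) (alpha'K : alpha \notin 1%VS).
Local Notation G := ('Gal({:L} / 1%VS))%g.
Hypotheses (Gsigma : sigma \in G) (sigma_alpha : sigma alpha = zeta%:A * alpha).

Lemma kummer_gal_cyclic s : s \in G -> exists i : 'I_p, s = (sigma ^+ i)%g.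
Proof.
move=> Gs; have [i Di] := gal_kummer_root p_pr prim_z nz_h0 Dh0 Gs.
exists (Ordinal (ltn_pmod i (prime_gt0 p_pr))) => /=.
have Ds : s alpha = (sigma ^+ (i %% p))%g alpha.
  by rewrite (galX_eigen _ sigma_alpha) prim_expr_mod.
apply/eqP/gal_eqP=> y _; have [P _ ->] := kummer_poly_gen p_pr Dh0 gen_alpha y.
have galP (t : gal_of {:L}) :
    t (map_poly (in_alg L) P).[alpha] = (map_poly (in_alg L) P).[t alpha].
  rewrite -horner_map -map_poly_comp; congr _.[_].
  by apply: eq_map_poly => k /=; rewrite rmorph_alg.
by rewrite !galP Ds.
Qed.

Lemma galNorm_prod_expg x : galNorm 1 {:L} x = \prod_(i < p) (sigma ^+ i)%g x.
Proof.
pose S := [set (sigma ^+ i)%g | i : 'I_p]%SET.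
have nz_alpha : alpha != 0 by apply: contraNneq alpha'K => ->; apply: mem0v.
have GS : G =i S.
  move=> s; apply/idP/imsetP=> [Gs | [i _ ->]]; last exact: groupX.
  by have [i ->] := kummer_gal_cyclic Gs; exists i.
rewrite /galNorm (eq_bigl _ _ GS) big_imset //= => i j _ _ Dij.
have := congr1 (fun s : gal_of {:L} => s alpha) Dij.
rewrite !(galX_eigen _ sigma_alpha) => /(mulIf nz_alpha)/eqP.
rewrite -!in_algE (inj_eq (fmorph_inj _)) (eq_prim_root_expr prim_z).
by rewrite !modn_small // => /eqP/val_inj.
Qed.

Lemma fixed_gal_generator y : sigma y = y -> galNorm 1 {:L} y = y ^+ p.
Proof.
move=> fix_y; rewrite galNorm_prod_expg -[p in RHS]card_ord -prodr_const.
by apply: eq_bigr => i _; rewrite galX_fix.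
Qed.

Lemma galNorm_base (a : K) : galNorm 1 {:L} a%:A = (a ^+ p)%:A.
Proof. by rewrite fixed_gal_generator ?(rmorph_alg sigma) // -!in_algE rmorphXn. Qed.

(** The identity that the product of the [1 - w^i * y] is [1 - y^p], read off the factorization of
    [X^p - 1] at [1/y]; hence [y = 0] is treated apart. *)
Lemma galNorm_one_sub y h w : y ^+ p = h%:A -> p.-primitive_root w ->
  sigma y = w%:A * y -> galNorm 1 {:L} (1 - y) = (1 - h)%:A.
Proof.
move=> Dh prim_w Dy; have p_gt0 := prime_gt0 p_pr.
rewrite -!in_algE rmorphB rmorph1 /= -Dh.
have [-> | nz_y] := eqVneq y 0.
  by rewrite expr0n gtn_eqF // !subr0 galNorm1.
have prim_wL : p.-primitive_root (in_alg L w) by rewrite fmorph_primitive_root.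
have /(congr1 (fun P => P.[y^-1])) := factor_Xn_sub_1 prim_wL.
rewrite hornerD hornerN hornerXn hornerC horner_prod big_mkord => Dprod.
rewrite galNorm_prod_expg; transitivity (y ^+ p * (y^-1 ^+ p - 1)); last first.
  by rewrite mulrBr mulr1 -exprMn divff // expr1n.
rewrite -Dprod -[p in y ^+ p]card_ord -prodr_const -big_split /=.
apply: eq_bigr => i _; rewrite hornerXsubC mulrBr divff //.
have -> : (sigma ^+ i)%g (1 - y) = 1 - (w ^+ i)%:A * y.
  by rewrite rmorphB rmorph1 -(galX_eigen _ Dy).
by rewrite -in_algE rmorphXn mulrC.
Qed.
End KummerNorm.

(** In a combination, the generator of least value divides the others; it exists unless all of them
    vanish. *)
Lemma gen_by_principal (F : fieldType) (V S : F -> Prop) x : is_valuation_ring V ->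
  gen_by V S x -> x = 0 \/ exists r s, [/\ V r, S s & x = r * s].
Proof.
move=> valV [n [r [s [Vr [Ss ->]]]]]; have subV := valV.1.
have [[i nz_si] | s0] := pselect (exists i, s i != 0); last first.
  by left; apply: big1 => i _; apply/eqP; rewrite mulf_eq0; apply/orP; right;
     apply: contrapT => /negP nz_si; apply: s0; exists i.
have [d /codomP[j ->] [nz_d min_d]] := valuation_min_seq valV (codom_f s i) nz_si.
right; exists (\sum_i r i * (s i / s j)), (s j); split=> //.
  by apply: subring_sum => // k _; apply: subringM => //; apply/min_d/codom_f.
by rewrite mulr_suml; apply: eq_bigr => k _; rewrite mulrA divfK.
Qed.

(** * The two inclusions between the ideals *)

Section MainTheorem.
Variables (K : fieldType) (L : splittingFieldType K) (A : K -> Prop).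
Variables (p : nat) (zeta h0 : K) (alpha : L) (sigma : gal_of {:L}).
Hypotheses (char0 : [pchar K] =i pred0) (henselA : is_henselian_valuation_ring A).
Hypotheses (p_pr : prime p) (max_p : max_ideal A p%:R).
Hypothesis prim_z : p.-primitive_root zeta.
Hypotheses (nz_h0 : h0 != 0) (Dh0 : alpha ^+ p = h0%:A).
Hypotheses (gen_alpha : <<1; alpha>>%VS = fullv) (alpha'K : alpha \notin 1%VS).
Local Notation G := ('Gal({:L} / 1%VS))%g.
Hypotheses (Gsigma : sigma \in G) (sigma_alpha : sigma alpha = zeta%:A * alpha).
Let valA : is_valuation_ring A := henselA.1.
Let subA : is_subring A := valA.1.
Let galL : galois 1 {:L} := pchar0_galois L char0.
Let p_gt0 : (0 < p)%N := prime_gt0 p_pr.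
Let zn1 : zeta - 1 != 0.
Proof. by rewrite subr_eq0 (zeta_neq1 p_pr prim_z). Qed.
Let nz_alpha : alpha != 0.
Proof. by apply: contraNneq alpha'K => ->; apply: mem0v. Qed.

(** If every solution in [L] lay in [K], the subfield [K] would have to be all of [L]. The solutions
    for [h = 1] are powers of [zeta], which excludes that value. *)
Lemma kummer_gens_root h : kummer_gens L p h ->
  exists y : L, [/\ y ^+ p = h%:A, y \notin 1%VS & h != 1].
Proof.
move=> gen_h; have [y Dy y'K] : exists2 y : L, y ^+ p = h%:A & y \notin 1%VS.
  apply: contrapT => noy; case/negP: alpha'K.
  have /= -> := gen_h 1%AS _; first exact: memvf.
  by move=> y Dy; apply: contrapT => /negP y'K; apply: noy; exists y.
exists y; split=> //; apply: contraNneq y'K => h1.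
have prim_zL : p.-primitive_root (in_alg L zeta) by rewrite fmorph_primitive_root.
have [|i ->] := prim_rootP prim_zL (_ : y ^+ p = 1); first by rewrite Dy h1 scale1r.
by rewrite -rmorphXn; apply/vlineP; exists (zeta ^+ i).
Qed.

Lemma kummer_gensP h y : y ^+ p = h%:A -> alpha \in <<1; y>>%VS -> kummer_gens L p h.
Proof.
move=> Dy y_alpha E rootE; apply/eqP; rewrite eqEsubv subvf -gen_alpha.
apply/FadjoinP; split; first exact: sub1v.
apply: subvP y_alpha; apply/FadjoinP; split; [exact: sub1v | exact: rootE].
Qed.

(** The solution [a / alpha] generates [L]; this [h] is the one that arises from the norm of
    [1 - a / alpha]. *)
Lemma kummer_gens_scale a : a != 0 -> kummer_gens L p (a ^+ p / h0).
Proof.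
move=> nz_a; apply: (@kummer_gensP _ (a%:A / alpha)).
  by rewrite expr_div_n Dh0 -!in_algE -rmorphXn -fmorph_div.
have Dalpha : alpha = a%:A / (a%:A / alpha).
  by rewrite invf_div mulrCA divff ?mulr1 // -in_algE fmorph_eq0.
rewrite [X in X \in _]Dalpha rpred_div ?memv_adjoin //; apply: (subvP (subv_adjoin _ _)).
by apply/vlineP; exists a.
Qed.

Lemma kummer_gens_gen : kummer_gens L p h0.
Proof. by apply: (kummer_gensP Dh0); apply: memv_adjoin. Qed.

Lemma root_of_unity_int z n : (0 < n)%N -> z ^+ n = 1 -> A z.
Proof.
move=> n_gt0 zn; have nz_z : z != 0.
  by apply: contra_eqN zn => /eqP->; rewrite expr0n gtn_eqF // eq_sym oner_eq0.
have [// | Azi] := valA.2 z nz_z.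
have -> : z = z^-1 ^+ n.-1.
  by apply: (mulIf (invr_neq0 nz_z)); rewrite divff // -exprSr prednK // exprVn zn invr1.
exact: subringX.
Qed.

Lemma H_gen_in_N h : kummer_gens L p h -> N_sigma A sigma ((zeta - 1) ^+ p / (h - 1)).
Proof.
move=> /kummer_gens_root[y [Dy y'K h1]].
have nz_y : y != 0 by apply: contraNneq y'K => ->; apply: mem0v.
have nz_h : h != 0.
  by rewrite -(fmorph_eq0 (in_alg L)) /= -Dy expf_neq0.
(* If the multiplier were not primitive, [sigma] would fix [x], and [x] would lie in [K]. *)
have prim_eigen x g : x ^+ p = g%:A -> g != 0 -> x \notin 1%VS ->
    exists2 w, p.-primitive_root w & sigma x = w%:A * x.
  move=> Dx nz_g x'K; have [i Di] := gal_kummer_root p_pr prim_z nz_g Dx Gsigma.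
  exists (zeta ^+ i) => //; rewrite (prim_root_exp_coprime _ prim_z) coprime_sym.
  rewrite prime_coprime //; apply: contra x'K => /dvdnP[q Dq].
  have fix_x : sigma x = x.
    by rewrite Di Dq mulnC exprM (prim_expr_order prim_z) expr1n scale1r mul1r.
  apply/vlineP; apply: fixed_alg => // s Gs.
  have [k ->] := kummer_gal_cyclic p_pr prim_z nz_h0 Dh0 gen_alpha sigma_alpha Gs.
  exact: galX_fix.
have [w prim_w Dw] := prim_eigen y h Dy nz_h y'K.
have [v prim_v Dv] : exists2 v, p.-primitive_root v & sigma y^-1 = v%:A * y^-1.
  apply: (prim_eigen _ h^-1); rewrite ?invr_eq0 ?rpredV //.
  by rewrite exprVn Dy -!in_algE fmorphV.
have yn1 : 1 - y != 0.
  by apply: contra y'K; rewrite subr_eq0 => /eqP <-; apply: mem1v.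
pose b := 1 - y^-1; have Db : b = - (1 - y) / y by rewrite /b; field.
have nz_b : b != 0 by rewrite Db mulf_neq0 ?oppr_eq0 ?invr_eq0.
have Dx : sigma b / b - 1 = (v - 1)%:A / (1 - y).
  have -> : sigma b = 1 - v%:A / y by rewrite /b rmorphB rmorph1; congr (_ - _).
  rewrite Db scalerBl scale1r; field.
  by rewrite oppr_eq0 yn1 nz_y.
have [n Dz] : exists n, zeta = v ^+ n.
  by have [i ->] := prim_rootP prim_v (prim_expr_order prim_z); exists i.
(* The root [v] need not be [zeta], but [zeta - 1 = (v - 1) * q] with [q] in [A]. *)
pose q := \sum_(i < n) v ^+ i.
have Aq : A q.
  apply: subring_sum => // i _; apply: subringX => //.
  exact: root_of_unity_int p_gt0 (prim_expr_order prim_v).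
have hn1 : 1 - h != 0 by rewrite subr_eq0 eq_sym.
have -> : (zeta - 1) ^+ p / (h - 1) = - q ^+ p * ((v - 1) ^+ p / (1 - h)).
  by rewrite Dz subrX1 -/q exprMn -(opprB 1 h) invrN; ring.
apply: gen_by_scale; first by apply: subringN => //; apply: subringX.
exists (sigma b / b - 1); split.
  exists 1%N, (fun=> 1), (fun=> sigma b / b - 1); rewrite big_ord1 mul1r.
  split; first by move=> _; apply: subring1; apply: int_closed_subring.
  by split=> // _; exists b.
rewrite Dx galNormM galNormV.
rewrite (galNorm_one_sub p_pr prim_z nz_h0 Dh0 gen_alpha alpha'K Gsigma sigma_alpha Dy prim_w Dw).
rewrite (galNorm_base p_pr prim_z nz_h0 Dh0 gen_alpha alpha'K Gsigma sigma_alpha).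
by rewrite -!in_algE -fmorph_div.
Qed.

Lemma norm_J_in_H c : norm_J A sigma c -> H_ideal L A p zeta c.
Proof.
case=> x [Jx Nx]; have valB := int_closed_valuation_ring henselA galL.
have subB := valB.1; have c_eq d : galNorm 1 {:L} x = d%:A -> c = d.
  by rewrite Nx -!in_algE => /fmorph_inj.
have [x0 | [r [_ [Br [b [nz_b ->]] Dx]]]] := gen_by_principal valB Jx.
  have -> : c = 0 by apply: c_eq; rewrite x0 galNorm0 scale0r.
  by exists 0%N, (fun=> 0), (fun=> 0); rewrite big_ord0; split=> [[] | ] //; split=> [[]|].
have [a Bu] := kummer_difference_bound_ext henselA char0 p_pr max_p prim_z
  nz_h0 Dh0 gen_alpha alpha'K sigma_alpha nz_b.
set u := _ / _ in Bu; have [e Ae Ne] := int_closed_galNorm henselA galL (subringM subB Br Bu).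
pose h := a ^+ p / h0; pose y := a%:A / alpha.
have Dy : y ^+ p = h%:A by rewrite expr_div_n Dh0 -!in_algE -rmorphXn -fmorph_div.
have sigma_y : sigma y = zeta^-1%:A * y.
  have -> : sigma y = a%:A / sigma alpha.
    by rewrite /y fmorph_div; congr (_ / _); apply: (rmorph_alg sigma).
  by rewrite sigma_alpha invfM mulrCA -!in_algE fmorphV.
have prim_zV : p.-primitive_root zeta^-1.
  have nz_z : zeta != 0 by rewrite (prim_root_eq0 prim_z) -lt0n.
  have -> : zeta^-1 = zeta ^+ p.-1.
    by apply: (mulIf nz_z); rewrite mulVf // -exprSr prednK // (prim_expr_order prim_z).
  by rewrite (prim_root_exp_coprime _ prim_z) coprimePn.
have Ny := galNorm_one_sub p_pr prim_z nz_h0 Dh0 gen_alpha alpha'K Gsigma sigma_alpha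
  Dy prim_zV sigma_y.
have alphaB : alpha - a%:A != 0.
  by apply: contra alpha'K; rewrite subr_eq0 => /eqP->; apply/vlineP; exists a.
(* Here [z * alpha / (alpha - a) = z / (1 - y)], so the norm of [x] is [e * z^p / (1 - h)]. *)
have Dxu : x = r * u * (zeta - 1)%:A / (1 - y).
  have nz_zL : zeta%:A - 1 != 0 :> L.
    by rewrite -in_algE -(rmorph1 (in_alg L)) -rmorphB fmorph_eq0.
  rewrite Dx /u /y scalerBl scale1r; field.
  apply/and4P; split=> //; rewrite -[X in _ - X]mul1r -mulrBl.
  exact: mulf_neq0.
have Dc : c = e * ((zeta - 1) ^+ p / (1 - h)).
  apply: c_eq; rewrite Dxu galNormM galNormM galNormV Ne Ny.
  rewrite (galNorm_base p_pr prim_z nz_h0 Dh0 gen_alpha alpha'K Gsigma sigma_alpha).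
  by rewrite -mulrA -!in_algE -fmorph_div -rmorphM.
rewrite Dc; have [a0 | nz_a] := eqVneq a 0; last first.
  have -> : e * ((zeta - 1) ^+ p / (1 - h)) = - e * ((zeta - 1) ^+ p / (h - 1)).
    by rewrite -(opprB h 1) invrN; ring.
  apply: gen_by_scale; first exact: subringN.
  by exists h; split=> //; apply: kummer_gens_scale.
(* For [a = 0] also [h = 0], which yields no generator. But then [c = e * z^p], and any admissible
   [g] in [A] gives [c = e * (g - 1) * (z^p / (g - 1))]; one of [h0], [1/h0] lies in [A]. *)
have [g gen_g Ag] : exists2 g, kummer_gens L p g & A g.
  have [Ah0 | Ah0] := valA.2 _ nz_h0; first by exists h0 => //; apply: kummer_gens_gen.
  exists h0^-1 => //; rewrite -[h0^-1]mul1r -(expr1n _ p).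
  by apply: kummer_gens_scale; apply: oner_neq0.
have [_ [_ _ gn1]] := kummer_gens_root gen_g.
have -> : e * ((zeta - 1) ^+ p / (1 - h)) = e * (g - 1) * ((zeta - 1) ^+ p / (g - 1)).
  rewrite /h a0 expr0n gtn_eqF // mul0r subr0 divr1.
  by field; rewrite subr_eq0.
apply: gen_by_scale; last by exists g.
by apply: subringM => //; apply: subringB => //; apply: subring1.
Qed.
End MainTheorem.

Theorem theorem1p3 (K : fieldType) (L : splittingFieldType K) (A : K -> Prop)
    (p : nat) (zeta h0 : K) (alpha : L) (sigma : gal_of {:L}) :
  [pchar K] =i pred0 ->
  is_henselian_valuation_ring A ->
  prime p -> max_ideal A p%:R ->
  p.-primitive_root zeta ->
  h0 != 0 -> alpha ^+ p = h0%:A ->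
  <<1; alpha>>%VS = fullv -> alpha \notin 1%VS ->
  sigma \in ('Gal({:L} / 1%VS))%g -> sigma alpha = zeta%:A * alpha ->
  forall c : K, H_ideal L A p zeta c <-> N_sigma A sigma c.
Proof.
move=> char0 henselA p_pr max_p prim_z nz_h0 Dh0 gen_alpha alpha'K Gsigma sigma_alpha c.
split; apply: gen_by_sub => [|y]; try exact: henselA.1.1.
  by case=> h [gen_h ->]; apply: (H_gen_in_N char0 henselA p_pr prim_z nz_h0 Dh0).
exact: (norm_J_in_H char0 henselA p_pr max_p prim_z nz_h0 Dh0).
Qed.
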